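(* Let $G$ be the Heawood graph and let $\Gamma \in M_G^{\mathrm{trop}}$ be any metric graph with underlying discrete graph $G$ (that is, any metric graph obtained by assigning arbitrary positive real lengths to the edges of $G$). Then there exists a divisor $D$ on $\Gamma$ of degree $7$ and rank $r_\Gamma(D) = 2$. Consequently, since $g(G)=8$ and $\rho(8,2,7) = -1$, every such metric graph $\Gamma$ is Brill-Noether special.
   Context: The Heawood graph is the Levi (incidence) graph of the Fano plane: it has 14 vertices, namely the 7 points and the 7 lines of the Fano plane $\mathbb{P}^2(\mathbb{F}_2)$, with an edge between a point and a line if and only if the point lies on the line. It is trivalent, with 21 edges and first Betti number $g(G)=8$. For a finite connected graph $G$, $M_G^{\mathrm{trop}}$ denotes the set of all metric graphs $\Gamma$ with underlying discrete graph $G$, i.e. the compact metric spaces obtained from $G$ by assigning a positive real length to each edge and identifying each edge with a closed interval of that length. The genus $g$ of $G$, and of $\Gamma$, is the first Betti number. A divisor on $\Gamma$ is a finite formal $\mathbb{Z}$-linear combination $D=\sum_i a_i p_i$ of points $p_i$ of $\Gamma$; its degree is $\sum_i a_i$, and it is effective if all $a_i \ge 0$. A rational function on $\Gamma$ is a continuous piecewise linear function $f:\Gamma\to\mathbb{R}$ with finitely many pieces and integer slopes; its divisor $\mathrm{div}(f)$ has coefficient at each point $p$ equal to the sum of the incoming slopes of $f$ at $p$. Two divisors are linearly equivalent if their difference is $\mathrm{div}(f)$ for some $f$. The (Baker-Norine) rank $r_\Gamma(D)$ is $-1$ if $D$ is not linearly equivalent to an effective divisor; otherwise it is the largest integer $r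 \geq 0$ such that $D-E$ is linearly equivalent to an effective divisor for every effective divisor $E$ of degree $r$ on $\Gamma$. The Brill-Noether number is $\rho(g,r,d) = g-(r+1)(g-d+r)$. Let $W^r_d(\Gamma)$ be the set of linear equivalence classes of divisors of degree $d$ and rank at least $r$ on $\Gamma$. The metric graph $\Gamma$ of genus $g$ is Brill-Noether general if, for all positive integers $r$ and $d$, $W^r_d(\Gamma)$ is empty when $\rho(g,r,d)<0$ and has dimension $\min\{\rho(g,r,d), g\}$ when $\rho(g,r,d)\ge 0$. Otherwise $\Gamma$ is Brill-Noether special. In particular, $\Gamma$ is Brill-Noether special if it carries a divisor of degree $d$ and rank at least $r$ for some positive integers $r,d$ with $\rho(g,r,d)<0$. *)

(* Defs.v *)
From HB Require Import structures.
From mathcomp Require Import all_boot all_order all_algebra.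
From mathcomp Require Import boolp classical_sets reals.
From mathcomp.multinomials Require Import freeg.

Set Implicit Arguments.
Unset Strict Implicit.
Unset Printing Implicit Defensive.

Import Order.TTheory GRing.Theory Num.Theory.

Local Open Scope ring_scope.

(** * Finite connected graphs *)

(* Loops and multiple edges are allowed.  The orientation src -> tgt of an edge
   is auxiliary: it only serves to parametrize the edge by an interval. *)
Definition adj (V E : finType) (src tgt : E -> V) : rel V :=
  fun x y => [exists e, ((src e == x) && (tgt e == y)) ||
                        ((src e == y) && (tgt e == x))].

Record graph := Graph {
  vert : finType;
  edge : finType;
  src : edge -> vert;
  tgt : edge -> vert;
  graph_neq0 : (0 < #|vert|)%N;
  graph_conn : forall x y : vert, connect (adj src tgt) x y
}.

Definition boundary_mx (G : graph) : 'M[rat]_(#|edge G|, #|vert G|) :=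
  \matrix_(i, j) ((tgt (enum_val i) == enum_val j)%:R
                  - (src (enum_val i) == enum_val j)%:R).

(* First Betti number: the dimension of the kernel of C_1 -> C_0. *)
Definition genus (G : graph) : nat := \rank (kermx (boundary_mx G)).

(** * Heawood graph *)

(* Over F_2 the only nonzero scalar is 1, so a point of P^2(F_2) is a nonzero
   vector p, and a line is a nonzero linear form a, containing p iff
   a(p) = 0. *)
Definition fano_point : finType := {v : 'rV['F_2]_3 | v != 0}.
Definition fano_line : finType := {a : 'rV['F_2]_3 | a != 0}.

Definition fano_inc (p : fano_point) (a : fano_line) : bool :=
  val p *m (val a)^T == 0.

Definition heawood_vert : finType := (fano_point + fano_line)%type.
Definition heawood_edge : finType :=
  {x : fano_point * fano_line | fano_inc x.1 x.2}.
Definition heawood_src (e : heawood_edge) : heawood_vert := inl (val e).1.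
Definition heawood_tgt (e : heawood_edge) : heawood_vert := inr (val e).2.

Lemma fano_common (u v : 'rV['F_2]_3) :
  exists2 w : 'rV['F_2]_3, w != 0 & (u *m w^T == 0) && (v *m w^T == 0).
Proof.
pose M := (col_mx u v)^T.
have K0 : kermx M != 0.
  rewrite -mxrank_eq0 mxrank_ker subn_eq0 -ltnNge.
  by apply: leq_ltn_trans (rank_leq_col M) _.
exists (nz_row (kermx M)); first by rewrite nz_row_eq0.
have /sub_kermxP/(congr1 trmx) : (nz_row (kermx M) <= kermx M)%MS.
  exact: nz_row_sub.
rewrite trmx_mul trmxK trmx0 mul_col_mx => /eqP.
by rewrite -[X in _ == X]col_mx0 => /eqP/eq_col_mx[-> ->]; rewrite !eqxx.
Qed.

Lemma heawood_neq0 : (0 < #|heawood_vert|)%N.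
Proof.
have [w w0 _] := fano_common 0 0.
by apply/card_gt0P; exists (inl (Sub w w0)).
Qed.

Lemma heawood_conn (x y : heawood_vert) :
  connect (adj heawood_src heawood_tgt) x y.
Proof.
have sym : connect_sym (adj heawood_src heawood_tgt).
  apply: sym_connect_sym => a b; rewrite /adj.
  by apply: eq_existsb => e; rewrite orbC.
have inc p a : fano_inc p a ->
    connect (adj heawood_src heawood_tgt) (inl p) (inr a).
  move=> pa; apply: connect1; apply/existsP; exists (Sub (p, a) pa).
  by rewrite /heawood_src /heawood_tgt SubK !eqxx.
have pts p q : connect (adj heawood_src heawood_tgt) (inl p) (inl q).
  have [w w0 /andP[pw qw]] := fano_common (val p) (val q).
  apply: (connect_trans (inc p (Sub w w0) _)); first by rewrite /fano_inc SubK.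
  by rewrite sym inc // /fano_inc SubK.
have lin a : exists p, connect (adj heawood_src heawood_tgt) (inr a) (inl p).
  have [w w0 /andP[aw _]] := fano_common (val a) 0.
  exists (Sub w w0); rewrite sym inc // /fano_inc SubK.
  by move/eqP/(congr1 trmx): aw; rewrite trmx_mul trmxK trmx0 => ->.
have to_pt z : exists p, connect (adj heawood_src heawood_tgt) z (inl p).
  by case: z => [p|a]; [exists p | exact: lin].
have [p xp] := to_pt x; have [q yq] := to_pt y.
by rewrite (connect_trans xp) // (connect_trans (pts p q)) // sym.
Qed.

Definition heawood : graph := Graph heawood_neq0 heawood_conn.

(** * Metric graphs *)

(* [metric_graph R G] is $M_G^{trop}$; the edge e is identified with the
   interval [0, len e], with 0 at src e and len e at tgt e. *)
Record metric_graph (R : realType) (G : graph) := MetricGraph {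
  len : edge G -> R;
  len_gt0 : forall e, 0 < len e
}.

Section MetricGraph.
Variables (R : realType) (G : graph) (Γ : metric_graph R G).

(* A point is a vertex, or a pair (e, t) in the interior of the edge e. *)
Definition is_point (x : vert G + edge G * R) : bool :=
  if x is inr (e, t) then 0 < t < len Γ e else true.

Definition mpoint : choiceType := {x : vert G + edge G * R | is_point x}.

Definition vertex_point (v : vert G) : mpoint := exist _ (inl v) isT.

(* The point at parameter t of the closed edge e, for 0 <= t <= len e. *)
Definition edge_point (e : edge G) (t : R) : mpoint :=
  insubd (vertex_point (if t <= 0 then src e else tgt e)) (inr (e, t)).

Definition divisor := {freeg mpoint / int}.

Definition effective (D : divisor) : Prop := forall p, 0 <= coeff p D.

(** * Rational functions *)

Definition pl_int (l : R) (u : R -> R) : Prop :=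
  exists (n : nat) (t : nat -> R) (m : nat -> int),
    [/\ t 0%N = 0, t n = l & forall i, (i < n)%N ->
        t i <= t i.+1 /\
        (forall x, t i <= x <= t i.+1 -> u x = u (t i) + (m i)%:~R * (x - t i))].

(* Slope of u at 0 to the right, when it is an integer. *)
Definition slope0 (u : R -> R) : int :=
  xget 0 [set m : int | exists2 eps : R, 0 < eps &
            forall s, 0 <= s < eps -> u s = u 0 + m%:~R * s].

(* An integral 1-chain: a PL function with integer slopes on each closed edge,
   values at a common endpoint of several edges being unrelated. *)
Definition chain (c : edge G -> R -> R) : Prop := forall e, pl_int (len Γ e) (c e).

Definition out_fwd (c : edge G -> R -> R) (e : edge G) (t : R) : int :=
  slope0 (fun s => c e (t + s)).
Definition out_bwd (c : edge G -> R -> R) (e : edge G) (t : R) : int :=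
  slope0 (fun s => c e (t - s)).

(* Sum of the incoming slopes at p, i.e. minus the sum of the slopes along the
   tangent directions at p.  A loop at v contributes two directions. *)
Definition ord (c : edge G -> R -> R) (p : mpoint) : int :=
  match val p with
  | inl v => - (\sum_(e | src e == v) out_fwd c e 0
                + \sum_(e | tgt e == v) out_bwd c e (len Γ e))
  | inr (e, t) => - (out_fwd c e t + out_bwd c e t)
  end.

Definition on_edges (f : mpoint -> R) (e : edge G) (t : R) : R :=
  f (edge_point e t).

(* Being PL on each closed edge, endpoints included, entails continuity. *)
Definition rational_fun (f : mpoint -> R) : Prop := chain (on_edges f).

Definition is_div (f : mpoint -> R) (D : divisor) : Prop :=
  forall p, coeff p D = ord (on_edges f) p.

Definition lin_equiv (D1 D2 : divisor) : Prop :=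
  exists2 f : mpoint -> R, rational_fun f & is_div f (D1 - D2).

(** * Rank *)

Definition equiv_effective (D : divisor) : Prop :=
  exists2 D' : divisor, effective D' & lin_equiv D D'.

Definition rank_ge (D : divisor) (r : nat) : Prop :=
  forall E : divisor, effective E -> deg E = r%:Z -> equiv_effective (D - E).

(* The set below is bounded by deg D, so its maximum exists as soon as it
   contains 0; the default value of xget is not used. *)
Definition rank (D : divisor) : int :=
  if `[< equiv_effective D >]
  then (xget 0%N [set r : nat | rank_ge D r /\
                    forall j, rank_ge D j -> (j <= r)%N])%:Z
  else -1.

(** * Brill-Noether loci *)

Definition pic_class (D : divisor) : set divisor := [set D' | lin_equiv D D'].

(* $W^r_d$ as a set of linear equivalence classes. *)
Definition W (r d : nat) : set (set divisor) :=
  [set pic_class D | D in [set D | deg D = d%:Z /\ r%:Z <= rank D]].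

(* Harmonic 1-forms, i.e. real 1-cycles. *)
Definition harmonic (w : edge G -> R) : Prop :=
  forall v, \sum_(e | tgt e == v) w e = \sum_(e | src e == v) w e.

Definition pairing (y w : edge G -> R) : R := \sum_e y e * w e.

(* Tropical Abel-Jacobi map.  Pic^0 of the metric graph is the real torus
   H_1(G, R)^* / H_1(G, Z): the class of D is the functional w |-> \int_c w for
   any integral 1-chain c with boundary D.  Here a chain is given by a primitive
   c of its multiplicity, so that \int_c w is the pairing of w with the
   increments of c; a vector y of R^E represents the functional
   w |-> pairing y w on harmonic forms. *)
Definition abel_jacobi (D : divisor) (y : edge G -> R) : Prop :=
  exists c : edge G -> R -> R,
    [/\ chain c, (forall p, coeff p D = ord c p) &
        forall w, harmonic w ->
          pairing (fun e => c e (len Γ e) - c e 0) w = pairing y w].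

Definition lin_comb (k : nat) (A : 'I_k -> edge G -> R) (x : 'I_k -> R)
  (e : edge G) : R := \sum_i x i * A i e.

(* Polyhedral dimension: S contains a k-dimensional cell, that is the translate
   by the class of D0 of the image of a small cube in a k-dimensional subspace
   of H_1(G, R)^*.  For k = 0 this says that S is nonempty.  The loci [W r d]
   are closed polyhedral subsets of the torus Pic^d, so this is the maximal
   dimension of their cells. *)
Definition dim_ge (S : set (set divisor)) (k : nat) : Prop :=
  exists (D0 : divisor) (A : 'I_k -> edge G -> R) (eps : R),
    [/\ 0 < eps,
        (forall x : 'I_k -> R,
           (forall w, harmonic w -> pairing (lin_comb A x) w = 0) ->
           forall i, x i = 0) &
        forall x : 'I_k -> R, (forall i, `|x i| < eps) ->
          exists2 D, S (pic_class D) & abel_jacobi (D - D0) (lin_comb A x)].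

Definition has_dim (S : set (set divisor)) (k : nat) : Prop :=
  dim_ge S k /\ ~ dim_ge S k.+1.

End MetricGraph.

Arguments W {R G} Γ r d.
Arguments divisor {R G} Γ.

Definition rho (g r d : nat) : int :=
  g%:Z - (r%:Z + 1) * (g%:Z - d%:Z + r%:Z).

Definition BN_general (R : realType) (G : graph) (Γ : metric_graph R G) : Prop :=
  forall r d : nat, (0 < r)%N -> (0 < d)%N ->
    (rho (genus G) r d < 0 -> W Γ r d = set0) /\
    (0 <= rho (genus G) r d ->
       has_dim (W Γ r d) `|Num.min (rho (genus G) r d) (genus G)%:Z|%N).

Definition BN_special (R : realType) (G : graph) (Γ : metric_graph R G) : Prop :=
  ~ BN_general Γ.

(* Main.v *)
Require Import Defs.
From mathcomp Require Import all_boot all_order all_algebra.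
From mathcomp Require Import boolp classical_sets reals.
From mathcomp.multinomials Require Import freeg.
From mathcomp Require Import zify ring lra.

(* The divisor is the sum D of the seven points of the Fano plane, whatever the
   lengths.  D - E is equivalent to an effective divisor as soon as some
   piecewise linear function f has, at each point, outgoing slopes of sum at
   least -(D - E), and these functions are stable under maximum.

   Reduction to vertices: let D - u and D - v be equivalent to effective
   divisors, where u and v are the ends of an edge, and let f1, f2 be
   corresponding functions, normalized to agree at a point x of the edge.  On
   the edge they agree exactly up to points a and b around x; max(f1, f2) has a
   spare chip both at a and at b, and moving these two chips toward each other
   brings one of them to x.  So the vertices of a loopless graph determine ranks.

   Rank at least 2: for E a sum of two vertices, f is determined by its values at
   the vertices; it vanishes outside a point p and the three lines through p, and
   it is obtained by letting chips flow toward p or one of these lines, each of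
   them stopping when the first chip arrives.

   Rank at most 2: for points p != q, the divisor D - 2p - q is p-reduced.

   Finally g = 21 - 14 + 1 = 8, and rho(8, 2, 7) = -1. *)

Import Order.TTheory GRing.Theory Num.Theory.
Set Implicit Arguments.
Unset Strict Implicit.
Unset Printing Implicit Defensive.
Local Open Scope ring_scope.


(** * Local slopes *)

(** The supremum of the initial segments on which [P] holds satisfies [P] by the limit step, and
    below [l] the right step would push it further. This stands in for compactness of an edge in the
    local-to-global arguments. *)
Lemma real_induction (R : realType) (l : R) (P : R -> Prop) :
  P 0 ->
  (forall s, 0 <= s < l -> P s ->
     exists2 e, 0 < e & forall r, s < r < s + e -> r <= l -> P r) ->
  (forall s, 0 < s <= l -> (forall r, 0 <= r < s -> P r) -> P s) ->
  forall s, 0 <= s <= l -> P s.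
Proof.
move=> P0 Pright Plim s /andP[s0 sl]; have l0 : 0 <= l by exact: le_trans sl.
pose S := [set x : R | 0 <= x <= l /\ forall r, 0 <= r <= x -> P r]%classic.
have S0 : S 0.
  by split=> [|r /le_anti <-//]; rewrite lexx.
have supS : has_sup S.
  by split; [exists 0 | exists l => x [/andP[]]].
have b0 : 0 <= sup S by apply: sup_upper_bound.
have bl : sup S <= l by apply: ge_sup; [exists 0 | move=> x [/andP[]]].
have ltb r : 0 <= r < sup S -> P r.
  case/andP=> r0 rb; have e0 : 0 < sup S - r by rewrite subr_gt0.
  have [x [_ Px] rx] := sup_adherent e0 supS.
  by apply: Px; rewrite r0 /= ltW //; move: rx; rewrite opprB subrKC.
have Pb : P (sup S).
  case: (ltgtP 0 (sup S)) b0 => // [b0|<- //] _.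
  by apply: Plim => //; rewrite b0.
have leb r : 0 <= r <= sup S -> P r.
  case/andP=> r0; rewrite le_eqVlt => /predU1P[-> //|rb].
  by apply: ltb; rewrite r0.
case: (ltP (sup S) l) => [bl'|lb]; last first.
  by apply: leb; rewrite s0 (le_trans sl).
have [|e e0 Pe] := Pright (sup S) _ Pb; first by rewrite b0.
pose x := Num.min l (sup S + e / 2).
have bx : sup S < x by rewrite lt_min bl' /=; lra.
have Sx : S x.
  split=> [|r /andP[r0 rx]].
    by rewrite (le_trans b0 (ltW bx)) /= ge_min lexx.
  case: (leP r (sup S)) => [rb|br]; first by apply: leb; rewrite r0.
  move: rx; rewrite le_min => /andP[rl re].
  by apply: Pe => //; rewrite br /=; lra.
by have := sup_upper_bound supS Sx; rewrite leNgt bx.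
Qed.

Section Slope.
Variable R : realType.
Implicit Types (u v : R -> R) (d t l : R) (m : int).

(* d is 1 or -1. *)
Definition slope d u t m : Prop :=
  exists2 eps : R, 0 < eps &
    forall s, 0 <= s < eps -> u (t + d * s) = u t + m%:~R * s.

Lemma slope_inj d u t m1 m2 : slope d u t m1 -> slope d u t m2 -> m1 = m2.
Proof.
move=> [e1 e10 h1] [e2 e20 h2]; pose s := Num.min e1 e2 / 2.
have s0 : 0 < s by rewrite divr_gt0 // lt_min e10.
have [s1 s2] : s < e1 /\ s < e2.
  by move: s0; rewrite /s; case: (leP e1 e2) => ?; lra.
have := h1 s; rewrite h2 ?(ltW s0) ?s2 // s1 => /(_ isT)/addrI/(mulIf (lt0r_neq0 s0)).
by move/intr_inj.
Qed.

Lemma eq_slope d u v t m :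
  (exists2 eps, 0 < eps & forall s, 0 <= s < eps -> u (t + d * s) = v (t + d * s)) ->
  slope d u t m -> slope d v t m.
Proof.
move=> [e1 e10 h1] [e2 e20 h2]; exists (Num.min e1 e2); first by rewrite lt_min e10.
move=> s /andP[s0]; rewrite lt_min => /andP[s1 s2].
rewrite -h1 ?s0 // h2 ?s0 //; congr (_ + _).
by have := h1 0; rewrite mulr0 addr0 lexx => ->.
Qed.

Lemma slopeD d u v t m1 m2 :
  slope d u t m1 -> slope d v t m2 -> slope d (u \+ v) t (m1 + m2).
Proof.
move=> [e1 e10 h1] [e2 e20 h2]; exists (Num.min e1 e2); first by rewrite lt_min e10.
move=> s /andP[s0]; rewrite lt_min => /andP[s1 s2] /=.
by rewrite h1 ?s0 // h2 ?s0 // intrD; ring.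
Qed.

Lemma slope_affine1 (a : R) (k : int) t : slope 1 (fun s => a + k%:~R * s) t k.
Proof. by exists 1 => // s _; ring. Qed.

Lemma slope_affineN1 (a : R) (k : int) t :
  slope (-1) (fun s => a + k%:~R * s) t (- k).
Proof. by exists 1 => // s _; rewrite intrN; ring. Qed.

Lemma slope_cst (a : R) d t : slope d (fun=> a) t 0.
Proof. by exists 1 => // s _; rewrite mul0r addr0. Qed.

Lemma slope_max_gt d u v t m1 m2 :
  slope d u t m1 -> slope d v t m2 -> v t < u t -> slope d (u \max v) t m1.
Proof.
move=> [e1 e10 h1] [e2 e20 h2] vu.
(* The slopes differ by less than [w], so [v] needs at least (u t - v t) / w to catch up with [u];
   the added 1 keeps [w] positive. *)
pose w : R := `|m2%:~R - m1%:~R| + 1.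
have w0 : 0 < w by rewrite ltr_wpDl.
exists (Num.min (Num.min e1 e2) ((u t - v t) / w)).
  by rewrite !lt_min e10 e20 divr_gt0 // subr_gt0.
move=> s /andP[s0]; rewrite !lt_min -andbA => /and3P[s1 s2].
rewrite ltr_pdivlMr // => s3 /=; rewrite (max_l (ltW vu)) max_l h1 ?s0 //.
rewrite h2 ?s0 // -subr_ge0.
have : (m2%:~R - m1%:~R) * s <= w * s.
  by apply: ler_wpM2r => //; rewrite /w (le_trans (ler_norm _)) // lerDl.
lra.
Qed.

Lemma slope_max_eq d u v t m1 m2 :
  slope d u t m1 -> slope d v t m2 -> u t = v t ->
  slope d (u \max v) t (Num.max m1 m2).
Proof.
move=> [e1 e10 h1] [e2 e20 h2] uv; exists (Num.min e1 e2); first by rewrite lt_min e10.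
move=> s /andP[s0]; rewrite lt_min => /andP[s1 s2] /=.
rewrite h1 ?s0 // h2 ?s0 // uv maxxx.
have [m12|m21] := leP m1 m2.
  by rewrite max_r // lerD2l ler_wpM2r // ler_int.
by rewrite max_l // lerD2l ler_wpM2r // ler_int ltW.
Qed.

(** Lower bounds are enough: a section is constrained only by slope sums from below. *)
Lemma slope_max d u v t m1 m2 :
  slope d u t m1 -> slope d v t m2 ->
  exists m, [/\ slope d (u \max v) t m, v t <= u t -> m1 <= m &
                u t <= v t -> m2 <= m].
Proof.
move=> h1 h2; case: (ltgtP (u t) (v t)) => uv.
- exists m2; split=> //; apply: eq_slope (slope_max_gt h2 h1 uv).
  by exists 1 => // s _ /=; rewrite maxC.
- by exists m1; split=> //; apply: slope_max_gt h2 uv.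
- by exists (Num.max m1 m2); rewrite !le_max !lexx orbT; split=> //; apply: slope_max_eq.
Qed.

Lemma slope0E d u t m : slope d u t m -> slope0 (fun s => u (t + d * s)) = m.
Proof.
move=> h; rewrite /slope0; set A := (X in xget _ X).
have Am : A m.
  by case: h => e e0 h; exists e => // s /h ->; rewrite mulr0 addr0.
have := xgetPex 0 (ex_intro _ _ Am); move: (xget 0 A) => k [e e0 he].
suff h' : slope d u t k by exact: slope_inj h' h.
by exists e => // s hs; rewrite he // mulr0 addr0.
Qed.

(** * Piecewise linear functions *)

Lemma partition_fwd (n : nat) (t : nat -> R) (x : R) :
  t 0%N <= x < t n -> exists2 i, (i < n)%N & t i <= x < t i.+1.
Proof.
elim: n => [|n IH]; first by move=> /andP[] /le_lt_trans h /h; rewrite ltxx.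
move=> /andP[x0 xn]; case: (ltP x (t n)) => xt; last by exists n => //; rewrite xt.
by have [|i iN h] := IH; [rewrite x0 | exists i => //; apply: leqW].
Qed.

Lemma partition_bwd (n : nat) (t : nat -> R) (x : R) :
  t 0%N < x <= t n -> exists2 i, (i < n)%N & t i < x <= t i.+1.
Proof.
elim: n => [|n IH]; first by move=> /andP[] /lt_le_trans h /h; rewrite ltxx.
move=> /andP[x0 xn]; case: (leP x (t n)) => xt; last by exists n => //; rewrite xt.
by have [|i iN h] := IH; [rewrite x0 | exists i => //; apply: leqW].
Qed.

Lemma pl_int_slope1 l u t : pl_int l u -> 0 <= t < l -> exists m, slope 1 u t m.
Proof.
move=> [n [b [k [b0 bn hk]]]]; rewrite -b0 -bn => /partition_fwd[i iN /andP[it ti]].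
have [_ h] := hk i iN.
exists (k i), (b i.+1 - t); first by rewrite subr_gt0.
move=> s /andP[s0 s1]; rewrite mul1r h; last by lra.
by rewrite (h t) ?it ?ltW //; ring.
Qed.

Lemma pl_int_slopeN1 l u t : pl_int l u -> 0 < t <= l -> exists m, slope (-1) u t m.
Proof.
move=> [n [b [k [b0 bn hk]]]]; rewrite -b0 -bn => /partition_bwd[i iN /andP[it ti]].
have [_ h] := hk i iN.
exists (- k i), (t - b i); first by rewrite subr_gt0.
move=> s /andP[s0 s1]; rewrite mulN1r h; last by lra.
by rewrite (h t) ?ti ?ltW // intrN; ring.
Qed.

(** Off the breakpoints the two outgoing slopes cancel, which makes the support of a principal
    divisor finite. *)
Lemma pl_int_break l u : pl_int l u ->
  exists s : seq R, forall t, 0 < t < l -> t \notin s ->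
    exists m, slope 1 u t m /\ slope (-1) u t (- m).
Proof.
move=> [n [b [k [b0 bn hk]]]]; exists [seq b i | i <- iota 0 n.+1] => t /andP[t0 tl] ts.
have [|i iN /andP[it ti]] := @partition_fwd n b t; first by rewrite b0 bn ltW.
have it' : b i < t.
  rewrite lt_neqAle it andbT; apply: contraNneq ts => <-.
  by apply: map_f; rewrite mem_iota add0n leq0n /= ltnS ltnW.
have [_ h] := hk i iN; exists (k i); split.
  exists (b i.+1 - t); first by rewrite subr_gt0.
  move=> s /andP[s0 s1]; rewrite mul1r h; last by lra.
  by rewrite (h t) ?it ?ltW //; ring.
exists (t - b i); first by rewrite subr_gt0.
move=> s /andP[s0 s1]; rewrite mulN1r h; last by lra.
by rewrite (h t) ?it ?ltW // intrN; ring.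
Qed.

Lemma pl_int_extend l l' u (m : int) : l <= l' -> pl_int l u ->
  (forall x, l <= x <= l' -> u x = u l + m%:~R * (x - l)) -> pl_int l' u.
Proof.
move=> ll' [n [b [k [b0 bn hk]]]] hm.
exists n.+1, (fun i => if (i <= n)%N then b i else l'),
       (fun i => if (i < n)%N then k i else m).
split; rewrite ?leq0n ?ltnn // => i; have [-> _|iNn iN] := eqVneq i n.
  by rewrite leqnn !ltnn bn.
have {}iN : (i < n)%N by rewrite ltn_neqAle iNn.
by rewrite ltnW // iN; apply: hk.
Qed.

(** Real induction on the right end: one linear piece is appended, either beyond [s] or, at a limit,
    from a nearby [r] up to [s]. *)
Lemma pl_int_local l u : 0 <= l ->
  (forall t, 0 <= t < l -> exists m, slope 1 u t m) ->
  (forall t, 0 < t <= l -> exists m, slope (-1) u t m) -> pl_int l u.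
Proof.
move=> l0 hr hl.
suff: forall s, 0 <= s <= l -> pl_int s u by apply; rewrite l0 lexx.
apply: real_induction => [|s sl plS|s sl IH].
- by exists 0%N, (fun=> 0), (fun=> 0); split.
- have [m [e e0 he]] := hr s sl; exists e => // r /andP[sr re] rl.
  apply: (@pl_int_extend s r u m (ltW sr) plS) => x /andP[sx xr].
  have := he (x - s); rewrite mul1r subrKC; apply.
  by rewrite subr_ge0 sx /=; lra.
- have [m [e e0 he]] := hl s sl; case/andP: sl => s0 sl.
  (* The half keeps [r] strictly inside the range of linearity to the left of [s], and the maximum
     keeps it nonnegative. *)
  pose r := Num.max 0 (s - e / 2).
  have [r0 rs re] : [/\ 0 <= r, r < s & s - e / 2 <= r].
    by rewrite /r; case: (leP 0 (s - e / 2)) => ?; split; lra.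
  apply: (@pl_int_extend r s u (- m) (ltW rs)); first by apply: IH; rewrite r0.
  have ux x : r <= x <= s -> u x = u s + m%:~R * (s - x).
    move=> /andP[rx xs]; have := he (s - x); rewrite mulN1r opprB subrKC.
    by apply; lra.
  move=> x xrs; rewrite (ux x) // (ux r) ?lexx ?ltW //.
  by rewrite intrN; ring.
Qed.

(** The condition at inner points is convexity, so the right slope never falls below its initial
    value. The induction carries this bound along with the inequality. *)
Lemma convex_above_tangent l u (m0 : int) :
  slope 1 u 0 m0 ->
  (forall t, 0 < t < l -> exists m1 m2,
     [/\ slope 1 u t m1, slope (-1) u t m2 & 0 <= m1 + m2]) ->
  (exists m, slope (-1) u l m) -> 0 < l ->
  u 0 + m0%:~R * l <= u l.
Proof.
move=> h0 hint [ml hml] l0.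
pose P s := u 0 + m0%:~R * s <= u s /\
            (s < l -> exists2 m, slope 1 u s m & m0 <= m).
suff: forall s, 0 <= s <= l -> P s by move/(_ l); rewrite lexx ltW // => /(_ isT)[].
apply: real_induction => [|s /andP[s0 sl] [us /(_ sl)[m [e e0 hm] m0m]]|s /andP[s0 sl] IH].
- by split=> [|_]; [rewrite mulr0 addr0 | exists m0].
- exists e => // r /andP[sr rse] rl; split=> [|_].
    have := hm (r - s); rewrite mul1r subrKC => ->; last by lra.
    have : m0%:~R * (r - s) <= m%:~R * (r - s).
      by rewrite ler_wpM2r ?ler_int // subr_ge0 ltW.
    lra.
  exists m => //; exists (s + e - r); first by lra.
  move=> x /andP[x0 xe]; rewrite mul1r.
  have ux y : s <= y < s + e -> u y = u s + m%:~R * (y - s).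
    by move=> ?; have := hm (y - s); rewrite mul1r subrKC; apply; lra.
  by rewrite (ux (r + x)) ?(ux r); [ring|lra|lra].
- have [m2 [e e0 hm2] hm1] : exists2 m2, slope (-1) u s m2 &
      s < l -> exists2 m1, slope 1 u s m1 & 0 <= m1 + m2.
    case: (ltP s l) => sl'; last first.
      by exists ml => //; have -> : s = l by apply/le_anti; rewrite sl.
    have [|m1 [m2 [? ? ?]]] := hint s; first by rewrite s0.
    by exists m2 => // _; exists m1.
  pose r := Num.max 0 (s - e / 2).
  have [r0 rs re] : [/\ 0 <= r, r < s & s - e / 2 <= r].
    by rewrite /r; case: (leP 0 (s - e / 2)) => ?; split; lra.
  have ux y : r <= y <= s -> u y = u s + m2%:~R * (s - y).
    move=> ?; have := hm2 (s - y); rewrite mulN1r opprB subrKC; apply; lra.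
  have [|ur /(_ (lt_le_trans rs sl))[m hm m0m]] := IH r; first by rewrite r0.
  (* On [r, s] the function is linear, so its right slope at [r], at least [m0] by induction, is the
     opposite of the outgoing left slope at [s]. *)
  have Em : m = - m2.
    apply: slope_inj hm _; exists (s - r); first by lra.
    by move=> y ?; rewrite mul1r (ux (r + y)) ?(ux r) ?intrN; [ring|lra|lra].
  split=> [|/hm1[m1 ? ?]]; last by exists m1 => //; move: m0m; lia.
  have : m0%:~R * (s - r) <= m%:~R * (s - r).
    by rewrite ler_wpM2r ?ler_int // subr_ge0 ltW.
  have := ux r; rewrite lexx ltW // => /(_ isT) Er.
  move: Er ur; rewrite Em intrN => Er ur h; lra.
Qed.

End Slope.
(** * Sections of a divisor *)

Section Sections.
Variables (R : realType) (G : graph) (Γ : metric_graph R G).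
Implicit Types (D E : divisor Γ) (f : mpoint Γ -> R) (c : edge G -> R -> R).
Local Notation vpt := (vertex_point Γ).
Local Notation ept := (edge_point Γ).

Definition chips (p : mpoint Γ) D : int := coeff p D.

Lemma chipsB p D E : chips p (D - E) = chips p D - chips p E.
Proof. exact: coeffB. Qed.

(* The function given by c e on the edge e and by phi on the vertices has
   effective D - div; a and b are its outgoing slopes at src and tgt. *)
Record is_section D c (phi : vert G -> R) (a b : edge G -> int) : Prop := IsSection {
  section_src : forall e, c e 0 = phi (src e);
  section_tgt : forall e, c e (len Γ e) = phi (tgt e);
  section_slope_src : forall e, slope 1 (c e) 0 (a e);
  section_slope_tgt : forall e, slope (-1) (c e) (len Γ e) (b e);
  section_interior : forall e t, 0 < t < len Γ e -> exists m1 m2,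
    [/\ slope 1 (c e) t m1, slope (-1) (c e) t m2 & - chips (ept e t) D <= m1 + m2];
  section_vertex : forall v, - chips (vpt v) D <=
    \sum_(e | src e == v) a e + \sum_(e | tgt e == v) b e
}.

Lemma slope0_fwd (u : R -> R) t m : slope 1 u t m -> slope0 (fun s => u (t + s)) = m.
Proof.
move=> /slope0E <-; congr slope0; apply/funext => s; by rewrite mul1r.
Qed.

Lemma slope0_bwd (u : R -> R) t m : slope (-1) u t m -> slope0 (fun s => u (t - s)) = m.
Proof.
move=> /slope0E <-; congr slope0; apply/funext => s; by rewrite mulN1r.
Qed.

Lemma edge_point_src e : ept e 0 = vpt (src e).
Proof. by apply: val_inj; rewrite val_insubd /= ltxx lexx. Qed.

Lemma edge_point_tgt e : ept e (len Γ e) = vpt (tgt e).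
Proof.
apply: val_inj; rewrite val_insubd /= ltxx andbF.
by rewrite leNgt (len_gt0 Γ e).
Qed.

Lemma val_edge_point e t : 0 < t < len Γ e -> val (ept e t) = inr (e, t).
Proof. by move=> h; rewrite val_insubd /= h. Qed.

Lemma mpointP p : (exists v, p = vpt v) \/
  (exists e t, 0 < t < len Γ e /\ p = ept e t).
Proof.
case: p => -[v|[e t]] h; [left|right].
  by exists v; apply: val_inj.
by exists e, t; split=> //; apply: val_inj; rewrite val_edge_point.
Qed.

Lemma ord_vertex c v a b :
  (forall e, slope 1 (c e) 0 (a e)) ->
  (forall e, slope (-1) (c e) (len Γ e) (b e)) ->
  ord c (vpt v) = - (\sum_(e | src e == v) a e + \sum_(e | tgt e == v) b e).
Proof.
move=> ha hb; rewrite /ord /=; congr (- (_ + _)); apply: eq_bigr => e _.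
  exact: slope0_fwd.
exact: slope0_bwd.
Qed.

Lemma ord_interior c e t m1 m2 : 0 < t < len Γ e ->
  slope 1 (c e) t m1 -> slope (-1) (c e) t m2 ->
  ord c (ept e t) = - (m1 + m2).
Proof.
move=> h h1 h2; rewrite /ord val_edge_point //.
by rewrite /out_fwd /out_bwd (slope0_fwd h1) (slope0_bwd h2).
Qed.

Lemma div_exists f : rational_fun f -> exists D : divisor Γ, is_div f D.
Proof.
move=> hf; have /fin_all_exists[s hs] := fun e => pl_int_break (hf e).
(* The support lies among the vertices and the breakpoints; a breakpoint at an end of an edge is a
   vertex again, whence [undup]. *)
pose pts := undup ([seq vpt v | v <- enum (vert G)] ++
                   [seq ept e t | e <- enum (edge G), t <- s e]).
exists (\sum_(q <- pts) << ord (on_edges f) q *g q >>) => p.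
rewrite /chips raddf_sum /= (eq_bigr (fun q => ord (on_edges f) q * (q == p)%:R)); last first.
  by move=> q _; rewrite coeffU.
have [ps|pNs] := boolP (p \in pts).
  rewrite (bigD1_seq p) ?undup_uniq //= eqxx mulr1 big1 ?addr0 // => q qp.
  by rewrite (negPf qp) mulr0.
rewrite big_seq big1 => [|q qs]; last first.
  by have [qp|] := eqVneq q p; [rewrite -qp qs in pNs | rewrite mulr0].
move: pNs; rewrite mem_undup mem_cat negb_or => /andP[pv pe].
have [[v pE]|[e [t [te pE]]]] := mpointP p; rewrite pE in pv pe *.
  by rewrite map_f ?mem_enum in pv.
have [|m [m1 m2]] := hs e t te.
  by apply: contraNN pe => ts; apply/allpairsPdep; exists e, t; rewrite mem_enum.
by rewrite (ord_interior te m1 m2) addrN oppr0.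
Qed.

(** An identity of divisors becomes inequalities on slopes, which survive maxima. One direction
    restricts [f] to the edges; the other glues the edge functions along [phi], and [D] minus the
    divisor of the result is effective. *)
Lemma equiv_effectiveP D :
  equiv_effective D <-> exists c phi a b, is_section D c phi a b.
Proof.
split=> [[D' D'0 [f hf Df]]|[c [phi [a [b [cs ct hs ht hint hv]]]]]].
  pose c := on_edges f.
  have {}Df p : chips p D - chips p D' = ord c p by rewrite -chipsB; apply: Df.
  have {}D'0 p : 0 <= chips p D' by apply: D'0.
  have /fin_all_exists[a ha] e : exists m, slope 1 (c e) 0 m.
    by apply: (pl_int_slope1 (hf e)); rewrite lexx len_gt0.
  have /fin_all_exists[b hb] e : exists m, slope (-1) (c e) (len Γ e) m.
    by apply: (pl_int_slopeN1 (hf e)); rewrite lexx len_gt0.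
  exists c, (fun v => f (vpt v)), a, b; split=> //.
  - by move=> e; rewrite /c /on_edges edge_point_src.
  - by move=> e; rewrite /c /on_edges edge_point_tgt.
  - move=> e t te; case/andP: (te) => t0 tl.
    have [|m1 h1] := pl_int_slope1 (t := t) (hf e); first by rewrite ltW.
    have [|m2 h2] := pl_int_slopeN1 (t := t) (hf e); first by rewrite t0 ltW.
    exists m1, m2; split=> //.
    have := Df (ept e t); rewrite (ord_interior te h1 h2).
    by have := D'0 (ept e t); lia.
  - move=> v; have := Df (vpt v); rewrite (ord_vertex v ha hb).
    by have := D'0 (vpt v); lia.
pose f (p : mpoint Γ) := match val p with inl v => phi v | inr (e, t) => c e t end.
(* The glued function agrees with [c e] only on the closed edge, [edge_point] being constant beyond
   each end, so only slopes pointing into the edge transfer. *)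
have fE e t : 0 <= t <= len Γ e -> on_edges f e t = c e t.
  case/andP; rewrite le_eqVlt => /predU1P[<- _|t0].
    by rewrite /on_edges edge_point_src cs.
  rewrite le_eqVlt => /predU1P[->|tl]; first by rewrite /on_edges edge_point_tgt ct.
  by rewrite /on_edges /f val_edge_point // t0.
have fwd e t m : 0 <= t < len Γ e -> slope 1 (c e) t m -> slope 1 (on_edges f e) t m.
  move=> /andP[t0 tl]; apply: eq_slope; exists (len Γ e - t); first by rewrite subr_gt0.
  by move=> s /andP[s0 sl]; rewrite mul1r fE //; apply/andP; split; lra.
have bwd e t m : 0 < t <= len Γ e -> slope (-1) (c e) t m -> slope (-1) (on_edges f e) t m.
  move=> /andP[t0 tl]; apply: eq_slope; exists t => //.
  by move=> s /andP[s0 sl]; rewrite mulN1r fE //; apply/andP; split; lra.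
have hs' e : slope 1 (on_edges f e) 0 (a e) by apply: fwd; rewrite // lexx len_gt0.
have ht' e : slope (-1) (on_edges f e) (len Γ e) (b e).
  by apply: bwd; rewrite // lexx len_gt0.
have rf : rational_fun f.
  move=> e; apply: pl_int_local => [|t /andP[]|t /andP[t0]]; first by rewrite ltW ?len_gt0.
    rewrite le_eqVlt => /predU1P[<- _|t0 tl]; first by exists (a e).
    have [|m1 [m2 [h1 _ _]]] := hint e t; first by rewrite t0.
    by exists m1; apply: fwd; rewrite // ltW.
  rewrite le_eqVlt => /predU1P[->|tl]; first by exists (b e).
  have [|m1 [m2 [_ h2 _]]] := hint e t; first by rewrite t0.
  by exists m2; apply: bwd; rewrite // t0 ltW.
have [Df hDf] := div_exists rf; have {}hDf p : chips p Df = ord (on_edges f) p by apply: hDf.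
 exists (D - Df).
  move=> p; rewrite -[coeff _ _]/(chips _ _) chipsB hDf subr_ge0.
  have [[v ->]|[e [t [te ->]]]] := mpointP p.
    by rewrite (ord_vertex v hs' ht'); have := hv v; lia.
  have [m1 [m2 [h1 h2 h]]] := hint e t te; case/andP: (te) => t0 tl.
  rewrite (ord_interior te (m1 := m1) (m2 := m2)); first by move: h; lia.
    by apply: fwd; rewrite // ltW.
  by apply: bwd; rewrite // t0 ltW.
by exists f => // p; rewrite opprB addrC subrK; apply: hDf.
Qed.

Lemma equiv_effective_le D E :
  (forall p, chips p D <= chips p E) -> equiv_effective D -> equiv_effective E.
Proof.
move=> DE /equiv_effectiveP[c [phi [a [b [cs ct hs ht hint hv]]]]].
apply/equiv_effectiveP; exists c, phi, a, b; split=> //.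
  move=> e t /hint[m1 [m2 [h1 h2 h]]]; exists m1, m2; split=> //.
  by apply: le_trans h; rewrite lerN2.
by move=> v; apply: le_trans (hv v); rewrite lerN2.
Qed.

Lemma effective_equiv_effective D : effective D -> equiv_effective D.
Proof.
move=> D0; apply/equiv_effectiveP; exists (fun _ _ => 0), (fun=> 0), (fun=> 0), (fun=> 0).
split=> // [e|e|e t _|v]; try exact: slope_cst.
  exists 0, 0; split; try exact: slope_cst.
  by rewrite addr0 oppr_le0.
by rewrite !sumr_const !mul0rn addr0 oppr_le0.
Qed.

(* On each edge, the section is the maximum of the two lines of slopes
   a e and b e issued from the values of phi at the ends. *)
Lemma equiv_effective_vertex D (phi : vert G -> R) (a b : edge G -> int) :
  (forall e t, 0 < t < len Γ e -> 0 <= chips (ept e t) D) ->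
  (forall e, phi (src e) + (a e)%:~R * len Γ e <= phi (tgt e)) ->
  (forall e, phi (tgt e) + (b e)%:~R * len Γ e <= phi (src e)) ->
  (forall v, - chips (vpt v) D <=
     \sum_(e | src e == v) a e + \sum_(e | tgt e == v) b e) ->
  equiv_effective D.
Proof.
move=> D0 ha hb hv; apply/equiv_effectiveP.
pose u e (s : R) := phi (src e) + (a e)%:~R * s.
pose w e (s : R) := phi (tgt e) + (b e)%:~R * len Γ e + (- b e)%:~R * s.
pose c e := u e \max w e.
have u0 e : u e 0 = phi (src e) by rewrite /u mulr0 addr0.
have wl e : w e (len Γ e) = phi (tgt e) by rewrite /w intrN; ring.
have c0 e : w e 0 <= u e 0 by rewrite u0 /w mulr0 addr0.
have cl e : u e (len Γ e) <= w e (len Γ e) by rewrite wl; apply: ha.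
(* The end slopes of the maximum may exceed [a] and [b]; this only adds chips. *)
have /fin_all_exists[a' ha'] e : exists m, slope 1 (c e) 0 m /\ a e <= m.
  have [m [h /(_ (c0 e)) am _]] :=
    slope_max (slope_affine1 (phi (src e)) (a e) 0)
      (slope_affine1 (phi (tgt e) + (b e)%:~R * len Γ e) (- b e) 0).
  by exists m.
have /fin_all_exists[b' hb'] e : exists m, slope (-1) (c e) (len Γ e) m /\ b e <= m.
  have [m [h _ /(_ (cl e)) bm]] :=
    slope_max (slope_affineN1 (phi (src e)) (a e) (len Γ e))
      (slope_affineN1 (phi (tgt e) + (b e)%:~R * len Γ e) (- b e) (len Γ e)).
  by exists m; rewrite -[b e]opprK.
exists c, phi, a', b'; split.
- by move=> e; rewrite -u0 [c e 0](max_l (c0 e)).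
- by move=> e; rewrite -wl [c e _](max_r (cl e)).
- by move=> e; have [] := ha' e.
- by move=> e; have [] := hb' e.
- move=> e t te.
  have [m1 [h1 l1 r1]] := slope_max (slope_affine1 (phi (src e)) (a e) t)
      (slope_affine1 (phi (tgt e) + (b e)%:~R * len Γ e) (- b e) t).
  have [m2 [h2 l2 r2]] := slope_max (slope_affineN1 (phi (src e)) (a e) t)
      (slope_affineN1 (phi (tgt e) + (b e)%:~R * len Γ e) (- b e) t).
  exists m1, m2; split=> //; have := D0 e t te.
  case: (leP (w e t) (u e t)) => [wu|/ltW uw].
    by have := l1 wu; have := l2 wu; lia.
  by have := r1 uw; have := r2 uw; lia.
- move=> v; apply: le_trans (hv v) _.
  by rewrite lerD // ler_sum // => e _; [have [] := ha' e | have [] := hb' e].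
Qed.

End Sections.

(** * Two functions on one edge, and a move of two chips *)

Section EdgeLemma.
Variables (R : realType).
Implicit Types (f g : R -> R).

(** Unless some segment of agreement ends at a point with distinct right slopes, real induction
    propagates the agreement up to [l]. *)
Lemma agree_right f g (l t0 : R) : t0 <= l -> f t0 = g t0 ->
  (forall t, t0 <= t < l -> exists m n, slope 1 f t m /\ slope 1 g t n) ->
  (forall t, t0 < t <= l -> exists m n, slope (-1) f t m /\ slope (-1) g t n) ->
  exists b, [/\ t0 <= b <= l, forall s, t0 <= s <= b -> f s = g s &
    b = l \/ b < l /\ exists m n, [/\ slope 1 f b m, slope 1 g b n & m != n]].
Proof.
move=> t0l fg0 hr hl.
have [//|none] := pselect (exists b, [/\ t0 <= b <= l, forall s, t0 <= s <= b -> f s = g s &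
    b < l /\ exists m n, [/\ slope 1 f b m, slope 1 g b n & m != n]]).
  by case=> b [b1 b2 b3]; exists b; split=> //; right.
exists l; split=> [|s /andP[ts sl]|]; [by rewrite t0l lexx| |by left].
(* The induction carries agreement on all of [t0, t0 + r], as [none] requires where the slopes
   differ. *)
suff: forall r, 0 <= r <= l - t0 -> forall x, 0 <= x <= r -> f (t0 + x) = g (t0 + x).
  move=> /(_ (s - t0)); rewrite subr_ge0 ts lerD2r sl => /(_ isT (s - t0)).
  by rewrite subr_ge0 ts lexx subrKC; apply.
apply: real_induction => [x /le_anti <-|r /andP[r0 rl] fgr|r /andP[r0 rl] fgr x /andP[x0 xr]].
- by rewrite addr0.
- have [|m [n [fm gn]]] := hr (t0 + r); first by apply/andP; split; lra.
  have mn : m = n.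
    apply/eqP/negPn/negP => mn; apply: none; exists (t0 + r); split.
    + by apply/andP; split; lra.
    + move=> s' /andP[ts' sr]; rewrite -(subrKC t0 s'); apply: fgr; apply/andP; split; lra.
    + by split; [lra | exists m, n].
  case: fm gn => e1 e10 fm [e2 e20 gn].
  exists (Num.min e1 e2); first by rewrite lt_min e10.
  move=> r' /andP[rr' r'e] r'l x /andP[x0 xr'].
  have [xr|rx] := leP x r; first by apply: fgr; rewrite x0.
  have /andP[xe1 xe2] : (x - r < e1) && (x - r < e2).
    by rewrite -lt_min; apply: le_lt_trans (_ : r' - r < _); lra.
  have fgr' : f (t0 + r) = g (t0 + r) by apply: fgr; rewrite r0 lexx.
  have -> : t0 + x = t0 + r + 1 * (x - r) by ring.
  by rewrite fm ?gn ?fgr' ?mn //; lra.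
have [xr'|rx] := ltP x r; first by apply: (fgr x); rewrite ?x0 ?lexx.
have {x x0 xr rx} -> : x = r by apply/le_anti; rewrite xr.
have [|m [n [[e1 e10 fm] [e2 e20 gn]]]] := hl (t0 + r); first by apply/andP; split; lra.
pose y := Num.min r (Num.min e1 e2) / 2.
have y0 : 0 < y by rewrite divr_gt0 // !lt_min r0 e10.
have [y1 y2 y3] : [/\ y < r, y < e1 & y < e2].
  have : y * 2 <= Num.min r (Num.min e1 e2) by rewrite /y mulfVK ?pnatr_eq0.
  by rewrite !le_min => /and3P[? ? ?]; split; lra.
(* To the left of [t0 + r] both functions are affine and equal; the equalities at y and y / 2
   together force equal values at [t0 + r] itself. *)
have eqy z : 0 < z <= y -> f (t0 + r) + m%:~R * z = g (t0 + r) + n%:~R * z.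
  move=> /andP[z0 zy]; rewrite -fm -?gn ?mulN1r -?addrA; try by apply/andP; split; lra.
  by apply: (fgr (r - z)); apply/andP; split; lra.
have := eqy y; have := eqy (y / 2); rewrite !mulrA lexx andbT y0 => h1 h2.
have := h2 isT; have := h1 _; have -> : 0 < y / 2 <= y by apply/andP; split; lra.
by move=> /(_ isT); lra.
Qed.

Lemma slope_reflect f (l t : R) m d :
  slope d (fun s => f (l - s)) t m <-> slope (- d) f (l - t) m.
Proof.
by split=> -[e e0 h]; exists e => // s /h; rewrite mulNr opprD addrA.
Qed.

Lemma agree_left f g (t0 : R) : 0 <= t0 -> f t0 = g t0 ->
  (forall t, 0 <= t < t0 -> exists m n, slope 1 f t m /\ slope 1 g t n) ->
  (forall t, 0 < t <= t0 -> exists m n, slope (-1) f t m /\ slope (-1) g t n) ->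
  exists b, [/\ 0 <= b <= t0, forall s, b <= s <= t0 -> f s = g s &
    b = 0 \/ 0 < b /\ exists m n, [/\ slope (-1) f b m, slope (-1) g b n & m != n]].
Proof.
move=> t00 fg0 hr hl.
have [|t ht|t ht|b [/andP[b0 bt] fgb hb]] :=
  @agree_right (fun s => f (t0 - s)) (fun s => g (t0 - s)) t0 0 t00.
- by rewrite subr0.
- have [|m [n [fm gn]]] := hl (t0 - t); first by apply/andP; split; lra.
  by exists m, n; split; apply/slope_reflect.
- have [|m [n [fm gn]]] := hr (t0 - t); first by apply/andP; split; lra.
  by exists m, n; split; apply/slope_reflect; rewrite opprK.
exists (t0 - b); split.
- by apply/andP; split; lra.
- by move=> s ?; have := fgb (t0 - s); rewrite opprB subrKC; apply; apply/andP; split; lra.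
case: hb => [->|[bl [m [n [/slope_reflect fm /slope_reflect gn mn]]]]].
  by left; rewrite subrr.
by right; split; [lra | exists m, n].
Qed.

(* The witness is max(al - s, -dl, s - be) on [al, be], where dl is the distance
   from t0 to the nearer of al and be, and 0 elsewhere. *)
Lemma trapezoid (al t0 be : R) : al < t0 < be ->
  exists K : R -> R, [/\ forall s, s <= al -> K s = 0, forall s, be <= s -> K s = 0 &
    forall s, exists k1 k2 : int, [/\ slope 1 K s k1, slope (-1) K s k2,
      (s == t0)%:Z - (s == al)%:Z - (s == be)%:Z <= k1 + k2,
      s <= al -> - (s == al)%:Z <= k1 & be <= s -> - (s == be)%:Z <= k2]].
Proof.
move=> /andP[a_t t_b]; pose dl := Num.min (t0 - al) (be - t0).
have [dl0 dl1 dl2] : [/\ 0 < dl, dl <= t0 - al & dl <= be - t0].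
  by rewrite lt_min !ge_min !lexx orbT !subr_gt0 a_t.
have dlE : dl = t0 - al \/ dl = be - t0.
  by rewrite /dl; case: leP => _; [left|right].
pose f1 s : R := al + (-1)%:~R * s.
pose f2 s : R := - dl + 0%:~R * s.
pose f3 s : R := - be + 1%:~R * s.
pose M := (f1 \max f2) \max f3.
pose K s := if (al <= s) && (s <= be) then M s else 0.
have f1E s : f1 s = al - s by rewrite /f1; ring.
have f2E s : f2 s = - dl by rewrite /f2; ring.
have f3E s : f3 s = s - be by rewrite /f3; ring.
have Ma : M al = 0.
  by rewrite /M /= f1E f2E f3E subrr (max_l (y := - dl)) ?max_l //; lra.
have Mb : M be = 0.
  by rewrite /M /= f1E f2E f3E subrr max_r // ge_max; apply/andP; split; lra.
have KM s : al <= s <= be -> K s = M s by rewrite /K => ->.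
have Ka s : s <= al -> K s = 0.
  move=> sa; rewrite /K; case: leP => //= as_; have -> : s = al by apply/le_anti; rewrite sa.
  by rewrite Ma if_same.
have Kb s : be <= s -> K s = 0.
  move=> sa; rewrite /K andbC; case: leP => //= as_.
  have -> : s = be by apply/le_anti; rewrite sa as_.
  by rewrite Mb if_same.
exists K; split=> // s.
have sf1 : slope 1 f1 s (-1) by apply: slope_affine1.
have sf2 : slope 1 f2 s 0 by apply: slope_affine1.
have sf3 : slope 1 f3 s 1 by apply: slope_affine1.
have sg1 : slope (-1) f1 s 1 by apply: slope_affineN1.
have sg2 : slope (-1) f2 s 0 by apply: slope_affineN1.
have sg3 : slope (-1) f3 s (-1) by apply: slope_affineN1.
have [m1 [sm1 l1 r1]] := slope_max sf1 sf2.
have [k1 [sk1 l2 r2]] := slope_max sm1 sf3.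
have [n1 [sn1 l3 r3]] := slope_max sg1 sg2.
have [k2 [sk2 l4 r4]] := slope_max sn1 sg3.
have right0 : s < al \/ be <= s -> slope 1 K s 0.
  case=> hs; apply: eq_slope (slope_cst 0 1 s).
    exists (al - s); first by lra.
    by move=> x ?; rewrite Ka //; lra.
  by exists 1 => // x ?; rewrite Kb //; lra.
have left0 : s <= al \/ be < s -> slope (-1) K s 0.
  case=> hs; apply: eq_slope (slope_cst 0 (-1) s).
    by exists 1 => // x ?; rewrite Ka //; lra.
  exists (s - be); first by lra.
  by move=> x ?; rewrite Kb //; lra.
have rightM : al <= s < be -> slope 1 K s k1.
  move=> /andP[? ?]; apply: eq_slope sk1; exists (be - s); first by lra.
  by move=> x ?; rewrite KM //; apply/andP; split; lra.
have leftM : al < s <= be -> slope (-1) K s k2.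
  move=> /andP[? ?]; apply: eq_slope sk2; exists (s - al); first by lra.
  by move=> x ?; rewrite KM //; apply/andP; split; lra.
have neq (x y : R) : x < y -> (x == y) = false /\ (y == x) = false.
  by move=> xy; rewrite lt_eqF // gt_eqF.
have [sa|as_|sa] := ltgtP s al.
- exists 0, 0; split=> //; [by apply: right0; left|by apply: left0; left; rewrite ltW| |].
    by have [-> _] := @neq s t0 (lt_trans sa a_t); rewrite addr0 sub0r oppr_le0.
  by move=> _; rewrite oppr_le0.
- have [sb|bs|sb] := ltgtP s be.
  + exists k1, k2; split; [by apply: rightM; rewrite ltW|by apply: leftM; rewrite as_ ltW| |by []|by []].
    rewrite !subr0; move: l1 r1 l2 r2 l3 r3 l4 r4; rewrite /= f1E f2E f3E.
    (* The flat piece meets the left or the right one exactly at [t0], according to which of [al]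
       and [be] is nearer; this corner is the chip gained there. *)
    have [->|st] := eqVneq s t0.
      case: dlE => dlE.
        have -> : al - t0 = - dl by lra.
        have bd : t0 - be <= - dl by lra.
        rewrite maxxx => _ r1 l2 _ l3 _ l4 _.
        by move: (r1 (lexx _)) (l2 bd) (l3 (lexx _)) (l4 bd); clear; lia.
      have -> : t0 - be = - dl by lra.
      have ad : al - t0 <= - dl by lra.
      rewrite (max_r ad) => _ _ _ r2 _ r3 l4 _.
      by move: (r2 (lexx _)) (r3 ad) (l4 (lexx _)); clear; lia.
    move=> l1 r1 l2 r2 l3 r3 l4 r4; have mn : 0 <= m1 + n1.
      case: (leP (- dl) (al - s)) => [h|/ltW h].
        by move: (l1 h) (l3 h); clear; lia.
      by move: (r1 h) (r3 h); clear; lia.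
    case: (leP (s - be) (Num.max (al - s) (- dl))) => [h|/ltW h].
      by move: (l2 h) (l4 h) mn; clear; lia.
    by move: (r2 h) (r4 h) mn; clear; lia.
  + exists 0, 0; split=> //; [by apply: right0; right; rewrite ltW|by apply: left0; right|].
    by have [_ ->] := @neq t0 s (lt_trans t_b bs); rewrite addr0 subr0.
  + exists 0, k2; split; [by apply: right0; right; rewrite sb|by apply: leftM; rewrite as_ sb /=| | |].
    * have [|_ ->] := neq t0 s; first by rewrite sb.
      rewrite subr0 !add0r; apply: le_trans (r4 _) => //.
      by rewrite /= f1E f2E f3E sb ge_max; apply/andP; split; lra.
    * by [].
    * move=> _; apply: le_trans (r4 _) => //.
      by rewrite /= f1E f2E f3E sb ge_max; apply/andP; split; lra.
- have sb : s < be by rewrite sa (lt_trans a_t).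
  have k1ge : -1 <= k1.
    apply: le_trans (l1 _) (l2 _); rewrite /= ?f1E ?f2E ?f3E sa; first by lra.
    by rewrite le_max; apply/orP; left; lra.
  exists k1, 0; split=> //; [by apply: rightM; rewrite sb sa lexx|by apply: left0; left; rewrite sa| |].
    have [|-> _] := neq s t0; first by rewrite sa.
    by have [-> _] := @neq s be sb; rewrite addr0 subr0 sub0r.
  by rewrite leNgt sb.
Qed.

End EdgeLemma.

(** * Vertices determine the rank *)

Section RankDetermining.
Variables (R : realType) (G : graph) (Γ : metric_graph R G).
Implicit Types (D E : divisor Γ) (c : edge G -> R -> R).
Local Notation vpt := (vertex_point Γ).
Local Notation ept := (edge_point Γ).

Lemma section_addC D c phi a b (k : R) : is_section D c phi a b ->
  is_section D (fun e => c e \+ (fun=> k)) (fun v => phi v + k) a b.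
Proof.
move=> [cs ct hs ht hint hv]; split=> //.
- by move=> e /=; rewrite cs.
- by move=> e /=; rewrite ct.
- by move=> e; rewrite -[a e]addr0; apply: slopeD => //; apply: slope_cst.
- by move=> e; rewrite -[b e]addr0; apply: slopeD => //; apply: slope_cst.
move=> e t /hint[m1 [m2 [h1 h2 h]]]; exists m1, m2; split=> //.
  by rewrite -[m1]addr0; apply: slopeD => //; apply: slope_cst.
by rewrite -[m2]addr0; apply: slopeD => //; apply: slope_cst.
Qed.

(* The third case of the interior condition: two sections with different slopes
   at a point where they agree have a maximum with an extra chip there. *)
Lemma section_max D1 D2 D c1 phi1 a1 b1 c2 phi2 a2 b2 :
  is_section D1 c1 phi1 a1 b1 -> is_section D2 c2 phi2 a2 b2 ->
  (forall v, (phi2 v <= phi1 v /\ chips (vpt v) D1 <= chips (vpt v) D) \/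
             (phi1 v <= phi2 v /\ chips (vpt v) D2 <= chips (vpt v) D)) ->
  (forall e t, 0 < t < len Γ e ->
     [\/ c2 e t <= c1 e t /\ chips (ept e t) D1 <= chips (ept e t) D,
         c1 e t <= c2 e t /\ chips (ept e t) D2 <= chips (ept e t) D |
         [/\ c1 e t = c2 e t,
             chips (ept e t) D1 <= chips (ept e t) D + 1,
             chips (ept e t) D2 <= chips (ept e t) D + 1 &
             exists d m n, [/\ d = 1 \/ d = -1, slope d (c1 e) t m,
               slope d (c2 e) t n & m != n]]]) ->
  exists a b, is_section D (fun e => c1 e \max c2 e) (fun v => Num.max (phi1 v) (phi2 v)) a b.
Proof.
move=> [cs1 ct1 hs1 ht1 hint1 hv1] [cs2 ct2 hs2 ht2 hint2 hv2] hv hint.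
have /fin_all_exists[a ha] e := slope_max (hs1 e) (hs2 e).
have /fin_all_exists[b hb] e := slope_max (ht1 e) (ht2 e).
exists a, b; split.
- by move=> e /=; rewrite cs1 cs2.
- by move=> e /=; rewrite ct1 ct2.
- by move=> e; have [] := ha e.
- by move=> e; have [] := hb e.
- move=> e t te; have [m1 [m2 [h1 h2 h]]] := hint1 e t te.
  have [n1 [n2 [k1 k2 k]]] := hint2 e t te.
  have [x1 [hx1 l1 r1]] := slope_max h1 k1.
  have [x2 [hx2 l2 r2]] := slope_max h2 k2.
  exists x1, x2; split=> //; have [[cc DD]|[cc DD]|[cc DD1 DD2 [d [m [n [hd dm dn mn]]]]]] := hint e t te.
  + by move: (l1 cc) (l2 cc) h DD; clear; lia.
  + by move: (r1 cc) (r2 cc) k DD; clear; lia.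
  + have cc1 : c1 e t <= c2 e t by rewrite cc.
    have cc2 : c2 e t <= c1 e t by rewrite cc.
    (* The slopes of the maximum dominate both pairs. As the pairs differ, their sum exceeds m1 + m2
       or n1 + n2 by at least 1, which pays for the extra chip. *)
    have mn12 : m1 <> n1 \/ m2 <> n2.
      case: hd => hd; rewrite hd in dm dn.
        by left=> /eqP; rewrite (slope_inj h1 dm) (slope_inj k1 dn); apply/negP.
      by right=> /eqP; rewrite (slope_inj h2 dm) (slope_inj k2 dn); apply/negP.
    move: mn12 (l1 cc2) (r1 cc1) (l2 cc2) (r2 cc1) h k DD1 DD2; clear; lia.
- move=> v; have [[cc DD]|[cc DD]] := hv v.
    apply: (le_trans (y := - chips (vpt v) D1)); first by rewrite lerN2.
    apply: le_trans (hv1 v) _.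
    rewrite lerD // ler_sum // => e /eqP ev.
      by have [_ + _] := ha e; rewrite cs1 cs2 ev; apply.
    by have [_ + _] := hb e; rewrite ct1 ct2 ev; apply.
  apply: (le_trans (y := - chips (vpt v) D2)); first by rewrite lerN2.
  apply: le_trans (hv2 v) _.
  rewrite lerD // ler_sum // => e /eqP ev.
    by have [_ _] := ha e; rewrite cs1 cs2 ev; apply.
  by have [_ _] := hb e; rewrite ct1 ct2 ev; apply.
Qed.

Lemma vertex_neq_edge v e t : 0 < t < len Γ e -> (vpt v == ept e t) = false.
Proof. by move=> te; rewrite -val_eqE /= val_edge_point. Qed.

Lemma edge_point_eq e t e' t' : 0 < t < len Γ e -> 0 < t' < len Γ e' ->
  (ept e t == ept e' t') = ((e == e') && (t == t')).
Proof. by move=> te te'; rewrite -val_eqE /= !val_edge_point. Qed.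

Lemma vertex_point_eq v w : (vpt v == vpt w) = (v == w).
Proof. by rewrite -val_eqE. Qed.

Lemma chipsB1 D p q : chips p (D - << q >>) = chips p D - (q == p)%:Z.
Proof. by rewrite chipsB; congr (_ - _); rewrite /chips coeffU mul1r natz. Qed.

(* Chips at the parameters al < t0 < be of an edge move toward each other until
   one of them reaches t0. *)
Lemma section_fire D c phi a b a' b' e0 (al t0 be : R) : src e0 != tgt e0 ->
  0 <= al < t0 -> t0 < be <= len Γ e0 ->
  is_section (D - << ept e0 al >>) c phi a b ->
  is_section (D - << ept e0 be >>) c phi a' b' ->
  equiv_effective (D - << ept e0 t0 >>).
Proof.
move=> loop /andP[al0 a_t] /andP[t_b bel] [cs ct hs ht hint1 hv1] [_ _ hs2 ht2].
(* One function serves for both divisors, so its end slopes coincide, and it can give up a chip at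
   [al] as well as at [be]. *)
have -> : a' = a by apply/funext => e; apply: slope_inj (hs2 e) (hs e).
have -> : b' = b by apply/funext => e; apply: slope_inj (ht2 e) (ht e).
move=> hint2 hv2 {hs2 ht2}.
have t0l : 0 < t0 < len Γ e0 by apply/andP; split; lra.
have [|K [Ka Kb Ks]] := @trapezoid R al t0 be; first by rewrite a_t.
have [k1 [_ [hk1 _ _ k1ge _]]] := Ks 0.
have [_ [k2 [_ hk2 _ _ k2ge]]] := Ks (len Γ e0).
have {}k1ge := k1ge al0; have {}k2ge := k2ge bel.
apply/equiv_effectiveP.
exists (fun e => if e == e0 then c e \+ K else c e), phi,
  (fun e => a e + (if e == e0 then k1 else 0)),
  (fun e => b e + (if e == e0 then k2 else 0)).
split.
- by move=> e; case: eqP => [->|_] //=; rewrite Ka // addr0.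
- by move=> e; case: eqP => [->|_] //=; rewrite Kb // addr0.
- by move=> e; case: eqP => [->|_]; [apply: slopeD | rewrite addr0].
- by move=> e; case: eqP => [->|_]; [apply: slopeD | rewrite addr0].
- move=> e t te; have [m1 [m2 [h1 h2 h]]] := hint1 e t te.
  have [n1 [n2 [g1 g2 g]]] := hint2 e t te.
  move: h g; rewrite (slope_inj g1 h1) (slope_inj g2 h2) !chipsB1 => h g.
  case: (eqVneq e e0) te h1 h2 {g1 g2} h g => [->|ne] te h1 h2 h g; last first.
    exists m1, m2; split=> //; apply: le_trans h.
    by rewrite edge_point_eq // eq_sym (negPf ne) lerN2 lerD2l oppr_le0.
  have [x1 [x2 [hx1 hx2 hx _ _]]] := Ks t.
  exists (m1 + x1), (m2 + x2); split; try exact: slopeD.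
  (* When [al] is 0 its chip sits at the source vertex and is charged in the vertex condition. *)
  have Ea : (ept e0 al == ept e0 t) = (t == al).
    have [->|al_neq] := eqVneq al 0.
      by rewrite edge_point_src vertex_neq_edge // gt_eqF //; case/andP: te.
    rewrite edge_point_eq // ?eqxx 1?eq_sym //.
    by apply/andP; split; [rewrite lt_neqAle eq_sym al_neq|lra].
  have Eb : (ept e0 be == ept e0 t) = (t == be).
    have [->|be_neq] := eqVneq be (len Γ e0).
      by rewrite edge_point_tgt vertex_neq_edge // lt_eqF //; case/andP: te.
    rewrite edge_point_eq // ?eqxx 1?eq_sym //.
    by apply/andP; split; [lra|rewrite lt_neqAle be_neq].
  move: hx h g; rewrite Ea Eb edge_point_eq // eqxx [t0 == t]eq_sym.
  have [->|_] := eqVneq t al; first by rewrite (lt_eqF a_t) (lt_eqF (lt_trans a_t t_b)); clear; lia.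
  by case: (t == t0); case: (t == be); clear; lia.
- move=> v; have := hv1 v; have := hv2 v; rewrite !chipsB1.
  rewrite [ept e0 t0 == _]eq_sym vertex_neq_edge // subr0.
  have sumD (P : pred (edge G)) (F : edge G -> int) k :
      \sum_(e | P e) (F e + (if e == e0 then k else 0)) = \sum_(e | P e) F e + (if P e0 then k else 0).
    rewrite big_split /= -big_mkcondr /=; congr (_ + _).
    case: ifP => Pe; last by rewrite big_pred0 // => e; case: eqP => [->|]; rewrite ?Pe ?andbF.
    by rewrite (big_pred1 e0) // => e; rewrite /= andbC; case: eqP => [->|].
  rewrite !sumD.
  have Ea : (ept e0 al == vpt v) = (0 == al) && (src e0 == v).
    have [<-|al_neq] /= := eqVneq 0 al; first by rewrite edge_point_src vertex_point_eq.
    rewrite eq_sym vertex_neq_edge //.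
    by apply/andP; split; [rewrite lt_neqAle al_neq|lra].
  have Eb : (ept e0 be == vpt v) = (len Γ e0 == be) && (tgt e0 == v).
    have [<-|be_neq] /= := eqVneq (len Γ e0) be; first by rewrite edge_point_tgt vertex_point_eq.
    rewrite eq_sym vertex_neq_edge //.
    by apply/andP; split; [lra|rewrite lt_neqAle eq_sym be_neq].
  rewrite Ea Eb; have [sv|_] := eqVneq (src e0) v; have [tv|_] := eqVneq (tgt e0) v.
  (* On a loop both chips could come from the same vertex, where only one is available. *)
  + by rewrite sv tv eqxx in loop.
  + by move: k1ge; case: (0 == al); rewrite ?andbF /=; clear; lia.
  + by move: k2ge; case: (_ == be); rewrite ?andbF /=; clear; lia.
  + by rewrite ?andbF /=; clear; lia.
Qed.

Lemma equiv_effective_edge D e0 t0 : src e0 != tgt e0 -> 0 < t0 < len Γ e0 ->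
  equiv_effective (D - << vpt (src e0) >>) ->
  equiv_effective (D - << vpt (tgt e0) >>) ->
  equiv_effective (D - << ept e0 t0 >>).
Proof.
move=> loop t0l /equiv_effectiveP[c1 [phi1 [a1 [b1 S1]]]].
move=> /equiv_effectiveP[c2' [phi2' [a2 [b2 S2']]]]; case/andP: (t0l) => t00 t0l'.
pose k := c1 e0 t0 - c2' e0 t0.
pose c2 e := c2' e \+ (fun=> k); pose phi2 v := phi2' v + k.
have S2 : is_section (D - << vpt (tgt e0) >>) c2 phi2 a2 b2 by apply: section_addC.
have c12 : c1 e0 t0 = c2 e0 t0 by rewrite /c2 /k /= subrKC.
have fwd t : 0 <= t < len Γ e0 -> exists m n, slope 1 (c1 e0) t m /\ slope 1 (c2 e0) t n.
  move=> /andP[]; rewrite le_eqVlt => /predU1P[<- _|t_0 t_l].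
    by exists (a1 e0), (a2 e0); split; [exact: section_slope_src S1 _ | exact: section_slope_src S2 _].
  have [|m [_ [hm _ _]]] := section_interior S1 (e := e0) (t := t); first by rewrite t_0.
  have [|n [_ [hn _ _]]] := section_interior S2 (e := e0) (t := t); first by rewrite t_0.
  by exists m, n.
have bwd t : 0 < t <= len Γ e0 -> exists m n, slope (-1) (c1 e0) t m /\ slope (-1) (c2 e0) t n.
  move=> /andP[t_0]; rewrite le_eqVlt => /predU1P[->|t_l].
    by exists (b1 e0), (b2 e0); split; [exact: section_slope_tgt S1 _ | exact: section_slope_tgt S2 _].
  have [|_ [m [_ hm _]]] := section_interior S1 (e := e0) (t := t); first by rewrite t_0.
  have [|_ [n [_ hn _]]] := section_interior S2 (e := e0) (t := t); first by rewrite t_0.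
  by exists m, n.
have [||be [/andP[tb bl] agb hb]] := agree_right (ltW t0l') c12.
- by move=> t /andP[? ?]; apply: fwd; apply/andP; split; lra.
- by move=> t /andP[? ?]; apply: bwd; apply/andP; split; lra.
have [||al [/andP[al0 alt] aga ha]] := agree_left (ltW t00) c12.
- by move=> t /andP[? ?]; apply: fwd; apply/andP; split; lra.
- by move=> t /andP[? ?]; apply: bwd; apply/andP; split; lra.
pose c e := c1 e \max c2 e; pose phi v := Num.max (phi1 v) (phi2 v).
(* At an inner point, the separation of the two functions on one side creates the extra chip. At an
   end of the edge none is needed: one of the two divisors has lost its chip exactly there. *)
have sec s : 0 <= s <= len Γ e0 -> c1 e0 s = c2 e0 s ->
    (0 < s < len Γ e0 -> exists d m n, [/\ d = 1 \/ d = -1, slope d (c1 e0) s m,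
       slope d (c2 e0) s n & m != n]) ->
    exists a b, is_section (D - << ept e0 s >>) c phi a b.
  move=> /andP[s0 sl] cs hs; apply: (section_max S1 S2) => [v|e t te]; last first.
    rewrite !chipsB1 !vertex_neq_edge // subr0.
    have [st|st] := boolP (ept e0 s == ept e t); last first.
      by rewrite subr0; case: (leP (c2 e t) (c1 e t)) => [?|/ltW ?]; [constructor 1|constructor 2].
    have s0l : 0 < s < len Γ e0.
      apply/negPn/negP; rewrite negb_and -!leNgt => /orP[s0'|ls'].
        have E : s = 0 by apply/le_anti; rewrite s0 s0'.
        by move: st; rewrite E edge_point_src vertex_neq_edge.
      have E : s = len Γ e0 by apply/le_anti; rewrite sl ls'.
      by move: st; rewrite E edge_point_tgt vertex_neq_edge.
    move: st; rewrite edge_point_eq // => /andP[/eqP <- /eqP <-].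
    by constructor 3; split; rewrite ?subrK //; apply: hs.
  have [/eqP sv|sv] := boolP (ept e0 s == vpt v); last first.
    rewrite !chipsB1 (negPf sv) subr0.
    by case: (leP (phi2 v) (phi1 v)) => [?|/ltW ?]; [left|right]; rewrite gerDl oppr_le0.
  have : s = 0 \/ s = len Γ e0.
    move: s0 sl; rewrite le_eqVlt => /predU1P[|s0]; first by left.
    rewrite le_eqVlt => /predU1P[|sl]; first by right.
    by have := @vertex_neq_edge v e0 s; rewrite sv eqxx s0 => /(_ sl).
  case=> E; rewrite E in sv cs *.
    rewrite edge_point_src in sv *; move/eqP: sv; rewrite vertex_point_eq => /eqP <-.
    left; split=> //.
    by move: cs; rewrite (section_src S1) (section_src S2) => ->.
  rewrite edge_point_tgt in sv *; move/eqP: sv; rewrite vertex_point_eq => /eqP <-.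
  right; split=> //.
  by move: cs; rewrite (section_tgt S1) (section_tgt S2) => ->.
have [a [b Sa]] : exists a b, is_section (D - << ept e0 al >>) c phi a b.
  apply: sec; [by apply/andP; split; lra | by apply: aga; rewrite lexx |].
  move=> /andP[al_0 _]; case: ha => [al_eq|[_ [m [n [? ? ?]]]]].
    by rewrite al_eq ltxx in al_0.
  by exists (-1), m, n; split=> //; right.
have [a' [b' Sb]] : exists a b, is_section (D - << ept e0 be >>) c phi a b.
  apply: sec; [by apply/andP; split; lra | by apply: agb; rewrite lexx tb |].
  move=> /andP[_ be_l]; case: hb => [be_eq|[_ [m [n [? ? ?]]]]].
    by rewrite be_eq ltxx in be_l.
  by exists 1, m, n; split=> //; left.
(* If [al] or [be] is [t0] itself, nothing has to move. *)
have [alE|al_neq] := eqVneq al t0.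
  by rewrite -alE; apply/equiv_effectiveP; exists c, phi, a, b.
have [beE|be_neq] := eqVneq t0 be.
  by rewrite beE; apply/equiv_effectiveP; exists c, phi, a', b'.
apply: (section_fire loop _ _ Sa Sb); first by rewrite al0 lt_neqAle al_neq.
by rewrite lt_neqAle be_neq tb.
Qed.

End RankDetermining.

(** * Computation of the rank *)

Section Rank.
Variables (R : realType) (G : graph) (Γ : metric_graph R G).
Implicit Types (D E : divisor Γ).
Local Notation vpt := (vertex_point Γ).

Lemma effective_seq E : effective E -> exists s : seq (mpoint Γ), E = \sum_(p <- s) << p >>.
Proof.
move=> E0; exists (flatten [seq nseq `|coeff z E|%N z | z <- dom E]).
rewrite big_flatten big_map /= -[LHS]freeg_sumE; apply: eq_bigr => z _.
rewrite big_nseq iter_addr addr0 freegU_muln natz gez0_abs //; exact: E0.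
Qed.

Lemma deg_sum (s : seq (mpoint Γ)) : deg (\sum_(p <- s) << p >> : divisor Γ) = (size s)%:Z.
Proof.
rewrite raddf_sum (eq_bigr (fun=> 1)) => [|p _]; last exact: degU.
by rewrite big_const_seq count_predT iter_addr addr0 natz.
Qed.

(** Induction on the points [s1] not yet replaced by vertices: by [equiv_effective_edge], a point
    inside an edge may be traded for the two ends, each of which joins [s2] in turn. *)
Lemma rank_ge_vertices D r : (forall e : edge G, src e != tgt e) ->
  (forall s : seq (vert G), size s = r -> equiv_effective (D - \sum_(v <- s) << vpt v >>)) ->
  rank_ge D r.
Proof.
move=> loopless hD E /effective_seq[s ->]; rewrite deg_sum => -[] sr.
suff: forall (s1 : seq (mpoint Γ)) (s2 : seq (vert G)), (size s1 + size s2 = r)%N ->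
    equiv_effective (D - \sum_(v <- s2) << vpt v >> - \sum_(p <- s1) << p >>).
  by move=> /(_ s [::]); rewrite addn0 big_nil subr0; apply.
elim=> [|p s1 IH] s2; first by rewrite big_nil subr0 => /hD.
have consE v : equiv_effective (D - \sum_(v <- v :: s2) << vpt v >> - \sum_(p <- s1) << p >>) ->
    equiv_effective (D - \sum_(v <- s2) << vpt v >> - \sum_(p <- s1) << p >> - << vpt v >>).
  by rewrite big_cons opprD addrA (addrAC D) (addrAC (D - _)).
rewrite big_cons opprD addrA addrAC /= addSn => sz.
have {IH}IH v : equiv_effective (D - \sum_(v <- s2) << vpt v >> - \sum_(p <- s1) << p >> - << vpt v >>).
  by apply: consE; apply: IH; rewrite /= addnS.
have [[v ->]|[e [t [te ->]]]] := mpointP p; first exact: IH.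
exact: equiv_effective_edge.
Qed.

Lemma rank_ge_leq D j k : (k <= j)%N -> rank_ge D j -> rank_ge D k.
Proof.
move=> kj hD E E0 Ek; have /card_gt0P[v _] := graph_neq0 G.
(* Padding [E] with chips at any vertex raises its degree from [k] to [j]; giving them back only
   helps. *)
pose F : divisor Γ := << vpt v >> *+ (j - k).
have F0 p : 0 <= coeff p F.
  by rewrite coeffMn coeffU mul1r natz mulrn_wge0.
apply: equiv_effective_le (hD (E + F) _ _) => [p||].
- rewrite -!/(chips _ _) !chipsB lerD2l lerN2 /chips coeffD lerDl; exact: F0.
- by move=> p; rewrite coeffD addr_ge0.
- by rewrite raddfD raddfMn /= Ek degU natz -PoszD subnKC.
Qed.

(** Monotonicity makes [r] the maximum of the set, so [xget] returns it; its case 0 selects the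
    first branch of [rank]. *)
Lemma rank_eq D r : rank_ge D r -> ~ rank_ge D r.+1 -> rank D = r%:Z.
Proof.
move=> hr hr1; rewrite /rank asboolT; last first.
  have /(_ 0) := rank_ge_leq (leq0n r) hr; rewrite subr0; apply; last exact: raddf0.
  by move=> p; rewrite coeff0.
have le j : rank_ge D j -> (j <= r)%N.
  by move=> hj; rewrite leqNgt; apply/negP => rj; apply: hr1; apply: rank_ge_leq rj hj.
set A := (X in xget _ X); have Ar : A r by split.
have [hx hmax] := xgetPex 0%N (ex_intro _ _ Ar).
by congr Posz; apply/eqP; rewrite eqn_leq le //= hmax.
Qed.

End Rank.

(** The transpose of the boundary matrix takes differences along edges, so by connectedness its
    kernel is the line of constants. Hence the boundary has rank one less than the number of
    vertices. *)
Lemma genus_euler (G : graph) : (genus G + #|vert G| = #|edge G| + 1)%N.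
Proof.
pose B := boundary_mx G; pose J : 'rV[rat]_(#|vert G|) := const_mx 1.
have BE (u : 'rV[rat]_(#|vert G|)) i :
    (u *m B^T) 0 i = u 0 (enum_rank (tgt (enum_val i))) - u 0 (enum_rank (src (enum_val i))).
  rewrite mxE (eq_bigr (fun j => u 0 j * (j == enum_rank (tgt (enum_val i)))%:R
      - u 0 j * (j == enum_rank (src (enum_val i)))%:R)); last first.
    by move=> j _; rewrite !mxE mulrBr -!(can2_eq enum_valK enum_rankK) ![_ == enum_val j]eq_sym.
  rewrite sumrB; congr (_ - _).
    rewrite (bigD1 (enum_rank (tgt (enum_val i)))) //= eqxx mulr1 big1 ?addr0 // => j /negPf ->.
    by rewrite mulr0.
  rewrite (bigD1 (enum_rank (src (enum_val i)))) //= eqxx mulr1 big1 ?addr0 // => j /negPf ->.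
  by rewrite mulr0.
have rk1 : \rank (kermx B^T) = 1%N.
  have /card_gt0P[v0 _] := graph_neq0 G.
  have J0 : J != 0.
    apply/eqP => /rowP /(_ (enum_rank v0)); rewrite !mxE => /eqP.
    by rewrite oner_eq0.
  have rJ : \rank J = 1%N by rewrite rank_rV J0.
  apply/eqP; rewrite eqn_leq -{1}rJ -{2}rJ; apply/andP; split; apply: mxrankS; last first.
    by apply/sub_kermxP/rowP => i; rewrite BE !mxE subrr.
  apply/row_subP => k; have /sub_kermxP := row_sub k (kermx B^T).
  move: (row k _) => u uB; apply/sub_rVP; exists (u 0 (enum_rank v0)).
  have adjE x y : adj (@src G) (@tgt G) x y -> u 0 (enum_rank x) = u 0 (enum_rank y).
    case/existsP => e exy; have : (u *m B^T) 0 (enum_rank e) = 0 by rewrite uB mxE.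
    rewrite BE enum_rankK => /eqP; rewrite subr_eq0 => /eqP ue.
    by case/orP: exy => /andP[/eqP <- /eqP <-].
  apply/rowP => i; rewrite !mxE mulr1 -[i]enum_valK.
  have /connectP[p] := graph_conn v0 (enum_val i).
  elim: p v0 {J0} => [|w p IH] v /=; first by move=> _ ->.
  by case/andP => /adjE -> /IH h /h.
move: rk1; rewrite /genus mxrank_ker -/B mxrank_ker mxrank_tr.
by have := rank_leq_row B; have := rank_leq_col B; lia.
Qed.

(** * Divisors supported on vertices *)

Section VertexCertificate.
Variables (R : realType) (G : graph) (Γ : metric_graph R G).
Implicit Types (D : divisor Γ).
Local Notation vpt := (vertex_point Γ).
Local Notation ept := (edge_point Γ).

(** Without chips inside the edges a section is convex on each of them, hence above its tangents at
    both ends; conversely the maximum of two such lines is a section. Finitely many inequalities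
    remain. *)
Lemma equiv_effective_vertexP D :
  (forall e t, 0 < t < len Γ e -> chips (ept e t) D = 0) ->
  equiv_effective D <-> exists (phi : vert G -> R) (a b : edge G -> int),
    [/\ forall e, phi (src e) + (a e)%:~R * len Γ e <= phi (tgt e),
        forall e, phi (tgt e) + (b e)%:~R * len Γ e <= phi (src e) &
        forall v, - chips (vpt v) D <=
          \sum_(e | src e == v) a e + \sum_(e | tgt e == v) b e].
Proof.
move=> D0; split=> [/equiv_effectiveP[c [phi [a [b [cs ct hs ht hint hv]]]]]|]; last first.
  by case=> phi [a [b [ha hb hv]]]; apply: (equiv_effective_vertex _ ha hb hv) => e t /D0 ->.
have int e t : 0 < t < len Γ e -> exists m1 m2,
    [/\ slope 1 (c e) t m1, slope (-1) (c e) t m2 & 0 <= m1 + m2].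
  by move=> te; have [m1 [m2 [h1 h2]]] := hint e t te; rewrite D0 // oppr0; exists m1, m2.
exists phi, a, b; split=> // e; rewrite -cs -ct.
  apply: convex_above_tangent; rewrite ?len_gt0 //; first exact: int.
  by exists (b e).
have := @convex_above_tangent R (len Γ e) (fun s => c e (len Γ e - s)) (b e).
rewrite subr0 subrr; apply; last exact: len_gt0.
- by apply/slope_reflect; rewrite subr0.
- move=> t te; have [|m1 [m2 [h1 h2 h]]] := int e (len Γ e - t).
    by case/andP: te => ? ?; apply/andP; split; lra.
  exists m2, m1; rewrite addrC; split=> //; first exact/slope_reflect.
  by apply/slope_reflect; rewrite opprK.
- by exists (a e); apply/slope_reflect; rewrite opprK subrr.
Qed.

End VertexCertificate.

(** * The Fano plane *)

Section Triad.
Variables (T : finType) (P : pred T) (x1 x2 x3 : T).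

Definition triad : Prop := uniq [:: x1; x2; x3] /\ forall x, P x = (x \in [:: x1; x2; x3]).

Lemma triad_mem : triad -> [/\ P x1, P x2 & P x3].
Proof. by case=> _ h; split; rewrite h !inE eqxx ?orbT. Qed.

Lemma triad_neq : triad -> [/\ (x1 == x2) = false, (x1 == x3) = false & (x2 == x3) = false].
Proof.
by case; rewrite /= !inE !negb_or -!andbA => /and4P[/negPf -> /negPf -> /negPf -> _].
Qed.

Lemma triad_sum (F : T -> int) : triad -> \sum_(x | P x) F x = F x1 + F x2 + F x3.
Proof.
by case=> u h; rewrite (eq_bigl _ _ h) -big_uniq // !big_cons big_nil /= addr0 addrA.
Qed.

Lemma triad_card : triad -> #|P| = 3.
Proof. by case=> u h; rewrite (eq_card (h : P =i [:: x1; x2; x3])); apply: (card_uniqP u). Qed.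

End Triad.

Section FanoPlane.
Local Notation F2 := ('F_2).
Implicit Types (p q : fano_point) (l k : fano_line).

Definition triple : Type := bool * bool * bool.

Definition triples : seq triple :=
  [seq (x.1, x.2, z) | x <- [:: (false, false); (false, true); (true, false); (true, true)],
                       z <- [:: false; true]].

Definition dot (s t : triple) : bool :=
  (s.1.1 && t.1.1) (+) (s.1.2 && t.1.2) (+) (s.2 && t.2).

(** Boolean coordinates turn statements on the plane into finite computations. Lines are coded too,
    [fano_line] being convertible to [fano_point]. *)
Definition code (p : fano_point) : triple :=
  (val p 0 0 != 0, val p 0 1 != 0, val p 0 2%:R != 0).

Lemma F2P (x : F2) : x = (x != 0)%:R.
Proof. by case: x => -[|[|//]] i; apply: val_inj. Qed.

Lemma bool_F2_neq0 (b : bool) : (b%:R != 0 :> F2) = b.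
Proof. by case: b. Qed.

Lemma mem_triples t : t \in triples.
Proof. by case: t => -[[] []] []. Qed.

Lemma I3P (P : 'I_3 -> Prop) : P 0 -> P 1 -> P 2%:R -> forall i, P i.
Proof.
move=> h0 h1 h2 [[|[|[|//]]] i].
- by rewrite (_ : Ordinal i = 0) //; apply: val_inj.
- by rewrite (_ : Ordinal i = 1) //; apply: val_inj.
- by rewrite (_ : Ordinal i = 2%:R) //; apply: val_inj.
Qed.

Lemma code_inj : injective code.
Proof.
move=> p q [h0 h1 h2]; apply/val_inj/rowP.
by apply: I3P; rewrite [LHS]F2P ?h0 ?h1 ?h2 -F2P.
Qed.

Lemma code_neq0 p : code p != (false, false, false).
Proof.
apply: contraNneq (valP p) => -[/negbFE/eqP h0 /negbFE/eqP h1 /negbFE/eqP h2].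
by apply/eqP/rowP; apply: I3P; rewrite ?h0 ?h1 ?h2 mxE.
Qed.

Lemma code_surj t : t != (false, false, false) -> exists p, code p = t.
Proof.
move=> t0; pose v : 'rV[F2]_3 := \row_i nth 0 [:: t.1.1%:R; t.1.2%:R; t.2%:R] i.
have vE : (v 0 0 != 0, v 0 1 != 0, v 0 2%:R != 0) = t.
  by rewrite !mxE /= !bool_F2_neq0; case: (t) => -[].
have v0 : v != 0.
  by apply: contraNneq t0 => v0; rewrite -vE v0 !mxE eqxx.
by exists (Sub v v0); rewrite /code SubK.
Qed.

Lemma inc_dot p l : fano_inc p l = ~~ dot (code p) (code l).
Proof.
rewrite /fano_inc; set M := val p *m _.
have -> : (M == 0) = (M 0 0 == 0).
  apply/eqP/eqP => [->|h]; first by rewrite mxE.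
  by apply/rowP => i; rewrite (ord1 i) h mxE.
rewrite mxE !big_ord_recl big_ord0 /= !mxE.
have E1 : fintype.lift ord0 ord0 = 1 :> 'I_3 by apply: val_inj.
have E2 : fintype.lift ord0 (fintype.lift ord0 ord0) = 2%:R :> 'I_3 by apply: val_inj.
rewrite !E1 !E2 /dot /code /=.
rewrite [val p 0 ord0]F2P [val l 0 ord0]F2P [val p 0 1]F2P [val l 0 1]F2P.
rewrite [val p 0 2%:R]F2P [val l 0 2%:R]F2P !bool_F2_neq0.
by do 6! [case: (_ != 0)].
Qed.

(** The dot product is a polarity: facts on the lines through a point dualize to facts on the points
    of a line. *)
Lemma fano_incC p l : fano_inc p l = fano_inc l p.
Proof. by rewrite !inc_dot; case: (code p) (code l) => -[[] []] [] [[[] []] []]. Qed.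

Lemma card_fano_point : #|fano_point| = 7.
Proof.
rewrite card_sub (eq_card (B := predC1 (0 : 'rV[F2]_3))) //.
by rewrite cardC1 card_mx card_Fp.
Qed.

Lemma fano_uniq p q l k : p != q -> fano_inc p l -> fano_inc q l ->
  fano_inc p k -> fano_inc q k -> l = k.
Proof.
(* Exhaustive check over the quadruples of codes, the zero triple being excluded by the premises. *)
have H : all (fun s => all (fun t => all (fun u => all (fun w =>
    [&& u != (false, false, false), w != (false, false, false),
        s != (false, false, false), t != (false, false, false),
        s != t, ~~ dot s u, ~~ dot t u, ~~ dot s w & ~~ dot t w] ==> (u == w))
    triples) triples) triples) triples by vm_compute.
move=> pq; rewrite !inc_dot => pl ql pk qk; apply: code_inj.
have /allP/(_ _ (mem_triples (code q))) := allP H _ (mem_triples (code p)).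
move=> /allP/(_ _ (mem_triples (code l)))/allP/(_ _ (mem_triples (code k))).
by rewrite !code_neq0 (inj_eq code_inj) pq pl ql pk qk => /eqP.
Qed.

Lemma fano_join p q : exists2 l, fano_inc p l & fano_inc q l.
Proof.
have [w w0 /andP[pw qw]] := fano_common (val p) (val q).
by exists (Sub w w0); rewrite /fano_inc SubK.
Qed.

Lemma fano_pencil p l1 : fano_inc p l1 -> exists l2 l3, triad (fano_inc p) l1 l2 l3.
Proof.
have H : all (fun s => all (fun u =>
    [&& u != (false, false, false), s != (false, false, false) & ~~ dot s u] ==>
    has (fun v => has (fun w =>
      [&& v != (false, false, false), w != (false, false, false), uniq [:: u; v; w] &
       all (fun x => (x != (false, false, false)) ==> (~~ dot s x == (x \in [:: u; v; w])))
       triples]) triples) triples)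
    triples) triples by vm_compute.
rewrite inc_dot => pl.
have /allP/(_ _ (mem_triples (code l1))) := allP H _ (mem_triples (code p)).
rewrite !code_neq0 pl => /hasP[v _ /hasP[w _ /and4P[v0 w0 uvw /allP hx]]].
have [l2 l2E] := code_surj v0; have [l3 l3E] := code_surj w0.
have sE : [:: code l1; v; w] = [seq code l | l <- [:: l1; l2; l3]] by rewrite /= l2E l3E.
exists l2, l3; split=> [|l]; first by rewrite -(map_inj_uniq code_inj) -sE.
have := hx _ (mem_triples (code l)); rewrite code_neq0 => /eqP.
by rewrite inc_dot => ->; rewrite sE mem_map //; apply: code_inj.
Qed.

Lemma fano_range l p1 : fano_inc p1 l -> exists p2 p3, triad (fano_inc^~ l) p1 p2 p3.
Proof.
rewrite fano_incC => /fano_pencil[p2 [p3 [u h]]]; exists p2, p3; split=> // p.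
by rewrite -h; apply: fano_incC.
Qed.

Lemma fano_pencil2 p l1 l2 : fano_inc p l1 -> fano_inc p l2 -> l1 != l2 ->
  exists l3, triad (fano_inc p) l1 l2 l3.
Proof.
move=> /fano_pencil[a [b [u h]]]; rewrite [fano_inc p l2]h !inE => /or3P[/eqP ->|/eqP ->|/eqP ->].
- by rewrite eqxx.
- by exists b.
exists a; split=> [|l]; last by rewrite h !inE [X in _ || X]orbC.
move: u; rewrite /= !inE !negb_or -!andbA => /and4P[-> -> ab _].
by rewrite eq_sym ab.
Qed.

Lemma fano_pencil_exists p : exists l1 l2 l3, triad (fano_inc p) l1 l2 l3.
Proof. by have [l pl _] := fano_join p p; exists l; apply: fano_pencil. Qed.

Lemma fano_range_exists l : exists p1 p2 p3, triad (fano_inc^~ l) p1 p2 p3.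
Proof.
have [p1 [p2 [p3 [u h]]]] := fano_pencil_exists l.
by exists p1, p2, p3; split=> // p; rewrite -h; apply: fano_incC.
Qed.

End FanoPlane.

(** * Divisors on the Heawood graph *)

Section Heawood.
Variables (R : realType) (Γ : metric_graph R heawood).
Implicit Types (D : divisor Γ) (p q : fano_point) (l k : fano_line).
Local Notation vpt := (vertex_point Γ).
Local Notation ept := (edge_point Γ).
Local Notation pv p := (inl p : vert heawood).
Local Notation lv l := (inr l : vert heawood).

(* Opaque, as unification would otherwise unfold the lengths of an edge down to
   the enumeration of the Fano plane. *)
Lemma flen_subproof : {f : fano_point -> fano_line -> R |
  (forall p l, 0 < f p l) /\
  forall e : edge heawood, f (val e).1 (val e).2 = len Γ e}.
Proof.
exists (fun p l => if insub (p, l) is Some e then len Γ e else 1); split=> [p l|e].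
  by case: insub => // e; apply: len_gt0.
by rewrite -surjective_pairing valK.
Qed.

Definition flen := sval flen_subproof.

Lemma flen_gt0 p l : 0 < flen p l.
Proof. exact: (svalP flen_subproof).1. Qed.

Lemma flenE (e : edge heawood) : flen (val e).1 (val e).2 = len Γ e.
Proof. exact: (svalP flen_subproof).2. Qed.

(** Every edge goes from a point to a line, so the second sum is empty and the first is reindexed by
    the lines through [p]. *)
Lemma sum_at_point (F : fano_point -> fano_line -> int) p :
  \sum_(e : edge heawood | src e == pv p) F (val e).1 (val e).2 +
  \sum_(e : edge heawood | tgt e == pv p) F (val e).1 (val e).2 =
  \sum_(l | fano_inc p l) F p l.
Proof.
rewrite [X in _ + X]big_pred0 ?addr0 //.
rewrite (eq_bigl (fun e => (val e).1 == p)) //.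
rewrite -(big_sub_cond _ (fun x : fano_point * fano_line => x.1 == p) (fun x => F x.1 x.2)).
rewrite (reindex (fun l => (p, l))) /=; last first.
  by exists snd => [//|[q l]]; rewrite inE /= => /andP[_ /eqP ->].
by apply: eq_bigl => l; rewrite eqxx andbT.
Qed.

Lemma sum_at_line (F : fano_point -> fano_line -> int) l :
  \sum_(e : edge heawood | src e == lv l) F (val e).1 (val e).2 +
  \sum_(e : edge heawood | tgt e == lv l) F (val e).1 (val e).2 =
  \sum_(p | fano_inc p l) F p l.
Proof.
rewrite big_pred0 ?add0r //.
rewrite (eq_bigl (fun e => (val e).2 == l)) //.
rewrite -(big_sub_cond _ (fun x : fano_point * fano_line => x.2 == l) (fun x => F x.1 x.2)).
rewrite (reindex (fun p => (p, l))) /=; last first.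
  by exists fst => [//|[q k]]; rewrite inE /= => /andP[_ /eqP ->].
by apply: eq_bigl => p; rewrite eqxx andbT.
Qed.

Lemma heawood_equiv_effectiveP D :
  (forall e t, 0 < t < len Γ e -> chips (ept e t) D = 0) ->
  equiv_effective D <-> exists (phi : fano_point -> R) (psi : fano_line -> R) a b,
    [/\ forall p l, fano_inc p l -> phi p + (a p l)%:~R * flen p l <= psi l,
        forall p l, fano_inc p l -> psi l + (b p l)%:~R * flen p l <= phi p,
        forall p, - chips (vpt (pv p)) D <= \sum_(l | fano_inc p l) a p l &
        forall l, - chips (vpt (lv l)) D <= \sum_(p | fano_inc p l) b p l].
Proof.
move=> D0; apply: (iff_trans (equiv_effective_vertexP D0)); split.
  case=> phi [a [b [ha hb hv]]].
  (* Extension by 0 from incident pairs to all pairs, so that the point and the line become separate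
     arguments. *)
  pose ext (f : edge heawood -> int) p l : int := if insub (p, l) is Some e then f e else 0.
  have extE f (e : edge heawood) : ext f (val e).1 (val e).2 = f e.
    by rewrite /ext -surjective_pairing valK.
  exists (fun p => phi (pv p)), (fun l => phi (lv l)), (ext a), (ext b); split.
  - by move=> p l pl; have := ha (Sub (p, l) pl); rewrite -flenE -(extE a) SubK.
  - by move=> p l pl; have := hb (Sub (p, l) pl); rewrite -flenE -(extE b) SubK.
  - move=> p; apply: le_trans (hv (pv p)) _; rewrite -sum_at_point.
    rewrite -(eq_bigr a (fun e _ => extE a e)) //.
    by rewrite [X in _ + X <= _]big_pred0 // [X in _ <= _ + X]big_pred0.
  - move=> l; apply: le_trans (hv (lv l)) _; rewrite -sum_at_line.
    rewrite -(eq_bigr b (fun e _ => extE b e)) //.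
    by rewrite [X in X + _ <= _]big_pred0 // [X in _ <= X + _]big_pred0.
case=> phi [psi [a [b [ha hb hp hl]]]].
exists (fun v => match v with inl p => phi p | inr l => psi l end),
  (fun e => a (val e).1 (val e).2), (fun e => b (val e).1 (val e).2); split.
- by move=> e; rewrite -flenE; apply: ha; apply: (valP e).
- by move=> e; rewrite -flenE; apply: hb; apply: (valP e).
case=> [p|l].
  apply: le_trans (hp p) _; rewrite -sum_at_point.
  by rewrite [X in _ + X <= _]big_pred0 // [X in _ <= _ + X]big_pred0.
apply: le_trans (hl l) _; rewrite -sum_at_line.
by rewrite [X in X + _ <= _]big_pred0 // [X in _ <= X + _]big_pred0.
Qed.

End Heawood.

(** * Flows along the three lines through a point *)

Section Star.
Variables (R : realType) (Γ : metric_graph R heawood).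
Implicit Types (D : divisor Γ) (p q : fano_point) (l k : fano_line).
Local Notation vpt := (vertex_point Γ).
Local Notation ept := (edge_point Γ).
Local Notation pv p := (inl p : vert heawood).
Local Notation lv l := (inr l : vert heawood).
Local Notation flen := (flen Γ).

(** With chips moving at unit speed from the points of [l] other than [p0], this is the time of the
    first arrival at [l]. *)
Definition min_len p0 l (m : R) : Prop :=
  (forall q, q != p0 -> fano_inc q l -> m <= flen q l) /\
  exists q, [/\ q != p0, fano_inc q l & flen q l = m].

(* For a potential equal to -T at p0, to -x at a line l through p0 at distance n,
   and to 0 at the other points of l, whose minimal distance to l is m: s bounds
   the slope at p0 towards l, and l keeps at least c chips. *)
Definition line_ok (m n T : R) (c s : int) (x : R) : Prop :=
  [/\ 0 <= x <= m, - T + s%:~R * n <= - x &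
      exists r : int, - x + r%:~R * n <= - T /\ c <= r + (x == m)%:Z].

(** The potential is -T at [p0], - x l at a line [l] through [p0], and 0 elsewhere. A point other
    than [p0] sends at most one chip, along its only line through [p0]; that line receives one when
    x l = m l. *)
Lemma star D p0 (T : R) (x m : fano_line -> R) (s : fano_line -> int) :
  (forall e t, 0 < t < len Γ e -> chips (ept e t) D = 0) ->
  (forall l, fano_inc p0 l -> min_len p0 l (m l)) ->
  (forall l, fano_inc p0 l -> line_ok (m l) (flen p0 l) T (- chips (vpt (lv l)) D) (s l) (x l)) ->
  (forall l, ~~ fano_inc p0 l -> 0 <= chips (vpt (lv l)) D) ->
  - chips (vpt (pv p0)) D <= \sum_(l | fano_inc p0 l) s l ->
  (forall q, q != p0 -> 1 <= chips (vpt (pv q)) D \/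
     0 <= chips (vpt (pv q)) D /\ forall l, fano_inc p0 l -> fano_inc q l -> x l = 0) ->
  equiv_effective D.
Proof.
move=> D0 hm ok hl hp hq; apply/(heawood_equiv_effectiveP D0).
have /fin_all_exists[r hr] l : exists r : int, fano_inc p0 l ->
    - x l + r%:~R * flen p0 l <= - T /\ - chips (vpt (lv l)) D <= r + (x l == m l)%:Z.
  have [p0l|_] := boolP (fano_inc p0 l); last by exists 0.
  by have [_ _ [r hr]] := ok l p0l; exists r.
exists (fun q => if q == p0 then - T else 0), (fun l => if fano_inc p0 l then - x l else 0),
  (fun q l => if q == p0 then s l else - (fano_inc p0 l && (x l != 0))%:Z),
  (fun q l => if fano_inc p0 l then if q == p0 then r l else (x l == flen q l)%:Z else 0).
split.
- move=> q l ql; have [qp|qp] := eqVneq q p0.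
    by rewrite -qp ql qp; have [] := ok l; rewrite // -qp.
  have [p0l|_] /= := boolP (fano_inc p0 l); last by rewrite oppr0 mul0r addr0.
  have [/andP[x0 xm] _ _] := ok l p0l; have := (hm l p0l).1 q qp ql.
  by case: eqP => [->|_] /=; lra.
- move=> q l ql; have [qp|qp] := eqVneq q p0.
    by rewrite -qp ql qp; have [] := hr l; rewrite // -qp.
  have [p0l|_] /= := boolP (fano_inc p0 l); last by rewrite mul0r addr0.
  have [/andP[x0 xm] _ _] := ok l p0l.
  by case: eqP => [->|_] /=; lra.
- move=> q; have [->|qp] := eqVneq q p0; first by [].
  have [k qk p0k] := fano_join q p0.
  have [q1|[q0 xq]] := hq q qp; last first.
    rewrite big1 ?oppr_le0 // => l ql; case: (boolP (fano_inc p0 l)) => //= p0l.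
    by rewrite xq // eqxx.
  apply: (@le_trans _ _ (-1)); first by rewrite lerN2.
  (* Only the line [k] joining [q] to [p0] can draw a chip from [q]. *)
  apply: (@le_trans _ _ (\sum_(l | fano_inc q l) - (l == k)%:Z)).
    rewrite (bigD1 k) //= eqxx big1 ?addr0 // => l /andP[_ /negPf ->].
    by rewrite oppr0.
  apply: ler_sum => l ql; have [->|lk] := eqVneq l k; first by case: andb.
  have [p0l|_] := boolP (fano_inc p0 l); last by [].
  by rewrite (fano_uniq qp ql p0l qk p0k) eqxx in lk.
- move=> l; have [p0l|p0l] := boolP (fano_inc p0 l); last first.
    by rewrite big1 // oppr_le0; apply: hl.
  have [_ h] := hr l p0l; apply: le_trans h _.
  rewrite (bigD1 p0) //= eqxx lerD2l.
  rewrite (eq_bigr (fun q => (x l == flen q l)%:Z)); last first.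
    by move=> q /andP[_ /negPf ->].
  have [_ [q1 [q1p q1l q1m]]] := hm l p0l.
  rewrite (bigD1 q1) /=; last by rewrite q1l.
  by rewrite -q1m lerDl sumr_ge0.
Qed.

(** Form of [star] with the lines named. The second alternative of the last condition is meant for
    [point_line_notinc], where only [l1] moves. *)
Lemma star3 D p0 l1 l2 l3 (T m1 m2 m3 x1 x2 x3 : R) (s1 s2 s3 : int) :
  triad (fano_inc p0) l1 l2 l3 ->
  min_len p0 l1 m1 -> min_len p0 l2 m2 -> min_len p0 l3 m3 ->
  line_ok m1 (flen p0 l1) T (- chips (vpt (lv l1)) D) s1 x1 ->
  line_ok m2 (flen p0 l2) T (- chips (vpt (lv l2)) D) s2 x2 ->
  line_ok m3 (flen p0 l3) T (- chips (vpt (lv l3)) D) s3 x3 ->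
  (forall e t, 0 < t < len Γ e -> chips (ept e t) D = 0) ->
  (forall l, ~~ fano_inc p0 l -> 0 <= chips (vpt (lv l)) D) ->
  - chips (vpt (pv p0)) D <= s1 + s2 + s3 ->
  (forall q, q != p0 -> 1 <= chips (vpt (pv q)) D \/
     [/\ 0 <= chips (vpt (pv q)) D, ~~ fano_inc q l1, x2 = 0 & x3 = 0]) ->
  equiv_effective D.
Proof.
move=> tr hm1 hm2 hm3 ok1 ok2 ok3 D0 hl hp hq.
pose sel (A : Type) (a b c : A) l := if l == l1 then a else if l == l2 then b else c.
have [l12 l13 l23] := triad_neq tr.
have sel1 A (a b c : A) : sel A a b c l1 = a by rewrite /sel eqxx.
have sel2 A (a b c : A) : sel A a b c l2 = b by rewrite /sel eq_sym l12 eqxx.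
have sel3 A (a b c : A) : sel A a b c l3 = c by rewrite /sel eq_sym l13 eq_sym l23.
apply: (@star D p0 T (sel R x1 x2 x3) (sel R m1 m2 m3) (sel int s1 s2 s3)) => //.
- by move=> l; rewrite [fano_inc _ _]tr.2 !inE => /or3P[] /eqP ->; rewrite ?(sel1, sel2, sel3).
- by move=> l; rewrite [fano_inc _ _]tr.2 !inE => /or3P[] /eqP ->; rewrite ?(sel1, sel2, sel3).
- by rewrite (triad_sum _ tr) sel1 sel2 sel3.
- move=> q /hq[|[q0 ql1 x20 x30]]; [by left|right; split=> // l].
  rewrite [fano_inc p0 l]tr.2 !inE => /or3P[] /eqP -> ql; rewrite ?(sel1, sel2, sel3) //.
  by rewrite ql in ql1.
Qed.

(** Chips flow toward [p0]: until time [m] they approach the line, then the first one travels on and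
    reaches [p0] at time m + n. *)
Lemma line_ok_keep (m n T : R) : 0 < m -> 0 < n -> 0 <= T <= m + n ->
  exists s x, [/\ line_ok m n T 0 s x, 0 <= s & T = m + n -> 1 <= s].
Proof.
move=> m0 n0 /andP[T0 Tmn]; have [mT|Tm] := leP m T; last first.
  exists 0, T; split=> // [|E]; last by exfalso; lra.
  split; [by rewrite T0 ltW|lra|exists 0; split; first lra].
  by case: (_ == _).
have [E|ne] := eqVneq T (m + n).
  exists 1, m; split=> //; split; [lra|lra|].
  by exists (-1); rewrite eqxx; split=> //; lra.
exists 0, m; split=> // [|/eqP]; last by rewrite (negPf ne).
by split; [lra|lra|exists (-1); rewrite eqxx; split=> //; lra].
Qed.

(** The line takes one chip, from [p0] or from its nearest other point, whichever comes first. At T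
    = m the latter arrives without any chip leaving [p0]. *)
Lemma line_ok_gain1 (m n T : R) : 0 < m -> 0 < n -> 0 <= T <= m ->
  exists s x, [/\ line_ok m n T 1 s x, -1 <= s & T = m -> 0 <= s].
Proof.
move=> m0 n0 /andP[T0 Tm]; have [E|ne] := eqVneq T m.
  exists 0, m; split=> //; split; [lra|lra|exists 0].
  by rewrite eqxx; split=> //; lra.
have [mT|Tm'] := leP m (T + n).
  exists (-1), m; split=> // [|/eqP]; last by rewrite (negPf ne).
  by split; [lra|lra|exists 0]; rewrite eqxx; split=> //; lra.
exists (-1), (T + n); split=> // [|/eqP]; last by rewrite (negPf ne).
split; [lra|lra|exists 1; split; first lra].
by rewrite lerDl.
Qed.

(** [p0] sends two chips; both arrive, or one of them together with a chip of the nearest other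
    point. At T = m - n a single chip from [p0] suffices. *)
Lemma line_ok_gain2 (m n T : R) : 0 < n -> 0 <= T <= m - n ->
  exists s x, [/\ line_ok m n T 2 s x, -2 <= s & T = m - n -> -1 <= s].
Proof.
move=> n0 /andP[T0 Tm]; have [E|ne] := eqVneq T (m - n).
  exists (-1), m; split=> //; split; [lra|lra|exists 1].
  by rewrite eqxx; split=> //; lra.
have [mT|Tm'] := leP m (T + 2 * n).
  exists (-2), m; split=> // [|/eqP]; last by rewrite (negPf ne).
  by split; [lra|lra|exists 1]; rewrite eqxx; split=> //; lra.
exists (-2), (T + 2 * n); split=> // [|/eqP]; last by rewrite (negPf ne).
split; [lra|lra|exists 2; split; first lra].
by rewrite lerDl.
Qed.

(** [T] is the time of the first of three events, when the flow stops. *)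
Lemma min3 (a b c : R) : 0 <= a -> 0 <= b -> 0 <= c ->
  exists T, [/\ 0 <= T <= a, T <= b, T <= c & [\/ T = a, T = b | T = c]].
Proof.
move=> a0 b0 c0; have [ab|ba] := leP a b; have [ac|ca] := leP a c.
- by exists a; split; [lra|lra|lra|constructor 1].
- by exists c; split; [lra|lra|lra|constructor 3].
- by exists b; split; [lra|lra|lra|constructor 2].
have [bc|cb] := leP b c.
  by exists b; split; [lra|lra|lra|constructor 2].
by exists c; split; [lra|lra|lra|constructor 3].
Qed.

Lemma min_len_exists p0 l : exists2 m, 0 < m & min_len p0 l m.
Proof.
have [q1 h1] : exists q, (q != p0) && fano_inc q l.
  have [p1 [p2 [p3 tr]]] := fano_range_exists l.
  have [p12 _ _] := triad_neq tr; have [p1l p2l _] := triad_mem tr.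
  have [E|ne] := eqVneq p1 p0; last by exists p1; rewrite ne.
  by exists p2; rewrite -E eq_sym p12.
have [q /andP[qp ql] hq] :=
  @arg_minP _ _ _ q1 (fun q => (q != p0) && fano_inc q l) (fun q => flen q l) h1.
exists (flen q l); first exact: flen_gt0.
by split=> [q' q'p q'l|]; [apply: hq; rewrite q'p | exists q].
Qed.

End Star.

(** * The sum of the seven points has rank 2 *)

Section RankTwo.
Variables (R : realType) (Γ : metric_graph R heawood).
Implicit Types (p q : fano_point) (l k : fano_line).
Local Notation vpt := (vertex_point Γ).
Local Notation ept := (edge_point Γ).
Local Notation pv p := (inl p : vert heawood).
Local Notation lv l := (inr l : vert heawood).
Local Notation flen := (flen Γ).

Definition point_sum : divisor Γ := \sum_(p : fano_point) << vpt (pv p) >>.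

Lemma deg_point_sum : deg point_sum = 7%:Z.
Proof.
rewrite /point_sum raddf_sum (eq_bigr (fun=> 1)) => [|p _]; last exact: degU.
by rewrite sumr_const card_fano_point natz.
Qed.

Lemma chips_point_sum x : chips x point_sum = [exists p, vpt (pv p) == x]%:Z.
Proof.
rewrite /chips /point_sum raddf_sum /=.
rewrite (eq_bigr (fun p => (vpt (pv p) == x)%:Z)) => [|p _]; last by rewrite coeffU mul1r natz.
case: existsP => [[p /eqP <-]|h].
  rewrite (bigD1 p) //= eqxx big1 ?addr0 // => q qp.
  by rewrite vertex_point_eq -[pv q == pv p]/(q == p) (negPf qp).
by rewrite big1 // => p _; case: eqP => // px; case: h; exists p; apply/eqP.
Qed.

Lemma chips_point_sum_point p : chips (vpt (pv p)) point_sum = 1.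
Proof. by rewrite chips_point_sum; case: existsP => [//|[]]; exists p. Qed.

Lemma chips_point_sum_line l : chips (vpt (lv l)) point_sum = 0.
Proof.
by rewrite chips_point_sum; case: existsP => [[p]|//]; rewrite vertex_point_eq.
Qed.

Lemma chips_point_sum_edge e t : 0 < t < len Γ e -> chips (ept e t) point_sum = 0.
Proof.
by move=> te; rewrite chips_point_sum; case: existsP => [[p]|//]; rewrite vertex_neq_edge.
Qed.

Definition chipsE :=
  (chipsB1, chips_point_sum_point, chips_point_sum_line, vertex_point_eq).

Lemma pair_chips_edge v w e t : 0 < t < len Γ e ->
  chips (ept e t) (point_sum - << vpt v >> - << vpt w >>) = 0.
Proof. by move=> te; rewrite !chipsB1 chips_point_sum_edge // !vertex_neq_edge. Qed.

Lemma inl_eq p q : (pv p == pv q) = (p == q). Proof. by []. Qed.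
Lemma inr_eq l k : (lv l == lv k) = (l == k). Proof. by []. Qed.
Lemma inl_inr p l : (pv p == lv l) = false. Proof. by []. Qed.
Lemma inr_inl p l : (lv l == pv p) = false. Proof. by []. Qed.
Definition vertE := (chipsE, inl_eq, inr_eq, inl_inr, inr_inl, @eqxx, subr0).

(** One chip is owed at [p]; chips flow toward it along its three lines until the first arrival pays
    the debt. *)
Lemma two_points_eq p :
  equiv_effective (point_sum - << vpt (pv p) >> - << vpt (pv p) >>).
Proof.
have [l1 [l2 [l3 tr]]] := fano_pencil_exists p.
have [m1 m1_0 hm1] := min_len_exists Γ p l1.
have [m2 m2_0 hm2] := min_len_exists Γ p l2.
have [m3 m3_0 hm3] := min_len_exists Γ p l3.
have n1_0 := flen_gt0 Γ p l1; have n2_0 := flen_gt0 Γ p l2; have n3_0 := flen_gt0 Γ p l3.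
have mn m l : 0 < m -> 0 <= m + flen p l by move=> ?; rewrite addr_ge0 // ltW // flen_gt0.
have [T [/andP[T0 T1] T2 T3 hT]] := min3 (mn m1 l1 m1_0) (mn m2 l2 m2_0) (mn m3 l3 m3_0).
have [|s1 [x1 [ok1 h1 k1]]] := line_ok_keep m1_0 n1_0 (T := T); first by rewrite T0.
have [|s2 [x2 [ok2 h2 k2]]] := line_ok_keep m2_0 n2_0 (T := T); first by rewrite T0.
have [|s3 [x3 [ok3 h3 k3]]] := line_ok_keep m3_0 n3_0 (T := T); first by rewrite T0.
apply: (star3 tr hm1 hm2 hm3 (T := T) (x1 := x1) (x2 := x2) (x3 := x3)
  (s1 := s1) (s2 := s2) (s3 := s3)); rewrite ?vertE ?oppr0 //.
- exact: pair_chips_edge.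
- by move=> l _; rewrite !vertE.
- by case: hT => [/k1|/k2|/k3]; move: h1 h2 h3; clear; lia.
- by move=> q qp; left; rewrite !vertE [p == q]eq_sym (negPf qp).
Qed.

Lemma two_points_neq p q : p != q ->
  equiv_effective (point_sum - << vpt (pv p) >> - << vpt (pv q) >>).
Proof.
move=> pq; apply: effective_equiv_effective => x; rewrite -/(chips _ _) !chipsB1.
rewrite chips_point_sum.
have [/eqP <-|_] := boolP (vpt (pv p) == x); have [/eqP E|_] := boolP (vpt (pv q) == _).
- by move/eqP: E; rewrite vertex_point_eq inl_eq eq_sym (negPf pq).
- by case: existsP => // -[]; exists p.
- by rewrite -E; case: existsP => // -[]; exists q.
- by case: existsP.
Qed.

(** The line may take its chip from [p], which has none left. At time [T] either another point of
    [l] supplies it without help from [p], or a chip reaches [p] along another line. *)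
Lemma point_line_inc p l : fano_inc p l ->
  equiv_effective (point_sum - << vpt (pv p) >> - << vpt (lv l) >>).
Proof.
move=> pl; have [l2 [l3 tr]] := fano_pencil pl.
have [l12 l13 l23] := triad_neq tr.
have [m1 m1_0 hm1] := min_len_exists Γ p l.
have [m2 m2_0 hm2] := min_len_exists Γ p l2.
have [m3 m3_0 hm3] := min_len_exists Γ p l3.
have n1_0 := flen_gt0 Γ p l; have n2_0 := flen_gt0 Γ p l2; have n3_0 := flen_gt0 Γ p l3.
have mn m k : 0 < m -> 0 <= m + flen p k by move=> ?; rewrite addr_ge0 // ltW // flen_gt0.
have [T [/andP[T0 T1] T2 T3 hT]] := min3 (ltW m1_0) (mn m2 l2 m2_0) (mn m3 l3 m3_0).
have [|s1 [x1 [ok1 h1 k1]]] := line_ok_gain1 m1_0 n1_0 (T := T); first by rewrite T0.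
have [|s2 [x2 [ok2 h2 k2]]] := line_ok_keep m2_0 n2_0 (T := T); first by rewrite T0.
have [|s3 [x3 [ok3 h3 k3]]] := line_ok_keep m3_0 n3_0 (T := T); first by rewrite T0.
apply: (star3 tr hm1 hm2 hm3 (T := T) (x1 := x1) (x2 := x2) (x3 := x3)
  (s1 := s1) (s2 := s2) (s3 := s3)); rewrite ?vertE ?l12 ?l13 ?oppr0 //.
- exact: pair_chips_edge.
- move=> k pk; rewrite !vertE; case: eqP => // lk.
  by rewrite -lk pl in pk.
- by case: hT => [/k1|/k2|/k3]; move: h1 h2 h3; clear; lia.
- by move=> q qp; left; rewrite !vertE [p == q]eq_sym (negPf qp).
Qed.

Lemma nearest_point l : exists p, [/\ fano_inc p l &
  forall m, min_len Γ p l m -> flen p l <= m].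
Proof.
have [p1 [p2 [p3 tr]]] := fano_range_exists l.
have [h1 _ _] := triad_mem tr.
have [p pl hp] := @arg_minP _ _ _ p1 (fun q => fano_inc q l) (fun q => flen q l) h1.
by exists p; split=> // m [_ [q [_ ql <-]]]; apply: hp.
Qed.

(** The points of [l] send their chips toward [l] by the distance of the nearest one, [p], whose
    chip arrives; [q] is off [l] and sends nothing. *)
Lemma point_line_notinc q l : ~~ fano_inc q l ->
  equiv_effective (point_sum - << vpt (pv q) >> - << vpt (lv l) >>).
Proof.
move=> ql; have [p [pl hp]] := nearest_point l.
have [l2 [l3 tr]] := fano_pencil pl.
have [l12 l13 l23] := triad_neq tr.
have [m1 m1_0 hm1] := min_len_exists Γ p l.
have [m2 m2_0 hm2] := min_len_exists Γ p l2.
have [m3 m3_0 hm3] := min_len_exists Γ p l3.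
have nm := hp _ hm1.
have n1_0 := flen_gt0 Γ p l.
have qp : (q == p) = false by apply: contraNF ql => /eqP ->.
apply: (star3 tr hm1 hm2 hm3 (T := 0) (x1 := flen p l) (x2 := 0) (x3 := 0)
  (s1 := -1) (s2 := 0) (s3 := 0)); rewrite ?vertE ?l12 ?l13 ?oppr0 //.
- split; [by rewrite ltW|lra|exists 1; split; first lra].
  by rewrite lerDl.
- by split; [by rewrite lexx ltW|lra|exists 0; split; [lra|]; rewrite lt_eqF].
- by split; [by rewrite lexx ltW|lra|exists 0; split; [lra|]; rewrite lt_eqF].
- exact: pair_chips_edge.
- move=> k pk; rewrite !vertE; case: eqP => // lk.
  by rewrite -lk pl in pk.
- by rewrite qp.
- move=> q' qp'; rewrite !vertE; have [<-|_] := eqVneq q q'; last by left.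
  by right; split.
Qed.

(** Each line may draw a chip from the common point [p], which owns only one. The event at time [T]
    either spares one of these or brings a chip along the third line. *)
Lemma two_lines_neq l1 l2 : l1 != l2 ->
  equiv_effective (point_sum - << vpt (lv l1) >> - << vpt (lv l2) >>).
Proof.
(* By duality [fano_join] also gives the intersection of two lines. *)
move=> ne; have [p pl1 pl2] := fano_join l1 l2.
rewrite fano_incC in pl1; rewrite fano_incC in pl2.
have [l3 tr] := fano_pencil2 pl1 pl2 ne.
have [l12 l13 l23] := triad_neq tr.
have [m1 m1_0 hm1] := min_len_exists Γ p l1.
have [m2 m2_0 hm2] := min_len_exists Γ p l2.
have [m3 m3_0 hm3] := min_len_exists Γ p l3.
have n1_0 := flen_gt0 Γ p l1; have n2_0 := flen_gt0 Γ p l2; have n3_0 := flen_gt0 Γ p l3.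
have mn m k : 0 < m -> 0 <= m + flen p k by move=> ?; rewrite addr_ge0 // ltW // flen_gt0.
have [T [/andP[T0 T1] T2 T3 hT]] := min3 (ltW m1_0) (ltW m2_0) (mn m3 l3 m3_0).
have [|s1 [x1 [ok1 h1 k1]]] := line_ok_gain1 m1_0 n1_0 (T := T); first by rewrite T0.
have [|s2 [x2 [ok2 h2 k2]]] := line_ok_gain1 m2_0 n2_0 (T := T); first by rewrite T0.
have [|s3 [x3 [ok3 h3 k3]]] := line_ok_keep m3_0 n3_0 (T := T); first by rewrite T0.
apply: (star3 tr hm1 hm2 hm3 (T := T) (x1 := x1) (x2 := x2) (x3 := x3)
  (s1 := s1) (s2 := s2) (s3 := s3));
  rewrite ?vertE ?[l2 == l1]eq_sym ?l12 ?l13 ?l23 ?oppr0 //.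
- exact: pair_chips_edge.
- move=> k pk; rewrite !vertE.
  have [lk|_] := eqVneq l1 k; first by rewrite -lk pl1 in pk.
  by have [lk|_] := eqVneq l2 k; first by rewrite -lk pl2 in pk.
- by case: hT => [/k1|/k2|/k3]; move: h1 h2 h3; clear; lia.
- by move=> q qp; left; rewrite !vertE.
Qed.

(* The chip of p, the point of l nearest to l, reaches l first; it is replaced by
   a chip coming to p along another line, which then goes to l in turn, unless a
   second point of l has already reached it. *)
Lemma two_lines_eq l :
  equiv_effective (point_sum - << vpt (lv l) >> - << vpt (lv l) >>).
Proof.
have [p [pl hp]] := nearest_point l.
have [l2 [l3 tr]] := fano_pencil pl.
have [l12 l13 l23] := triad_neq tr.
have [m1 m1_0 hm1] := min_len_exists Γ p l.
have [m2 m2_0 hm2] := min_len_exists Γ p l2.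
have [m3 m3_0 hm3] := min_len_exists Γ p l3.
have nm := hp _ hm1.
have n1_0 := flen_gt0 Γ p l; have n2_0 := flen_gt0 Γ p l2; have n3_0 := flen_gt0 Γ p l3.
have mn m k : 0 < m -> 0 <= m + flen p k by move=> ?; rewrite addr_ge0 // ltW // flen_gt0.
have nm0 : 0 <= m1 - flen p l by rewrite subr_ge0.
have [T [/andP[T0 T1] T2 T3 hT]] := min3 nm0 (mn m2 l2 m2_0) (mn m3 l3 m3_0).
have [|s1 [x1 [ok1 h1 k1]]] := line_ok_gain2 (m := m1) n1_0 (T := T); first by rewrite T0.
have [|s2 [x2 [ok2 h2 k2]]] := line_ok_keep m2_0 n2_0 (T := T); first by rewrite T0.
have [|s3 [x3 [ok3 h3 k3]]] := line_ok_keep m3_0 n3_0 (T := T); first by rewrite T0.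
apply: (star3 tr hm1 hm2 hm3 (T := T) (x1 := x1) (x2 := x2) (x3 := x3)
  (s1 := s1) (s2 := s2) (s3 := s3)); rewrite ?vertE ?l12 ?l13 ?oppr0 //.
- exact: pair_chips_edge.
- move=> k pk; rewrite !vertE.
  by have [lk|_] := eqVneq l k; first by rewrite -lk pl in pk.
- by case: hT => [/k1|/k2|/k3]; move: h1 h2 h3; clear; lia.
- by move=> q qp; left; rewrite !vertE.
Qed.

Lemma rank_ge_point_sum : rank_ge point_sum 2.
Proof.
apply: rank_ge_vertices => // -[//|v [//|w [|//]]] _.
rewrite !big_cons big_nil addr0 opprD addrA.
have point_line p l : equiv_effective (point_sum - << vpt (pv p) >> - << vpt (lv l) >>).
  by have [|] := boolP (fano_inc p l); [apply: point_line_inc|apply: point_line_notinc].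
case: v w => [p|l] [q|k].
- have [->|] := eqVneq p q; [exact: two_points_eq|exact: two_points_neq].
- exact: point_line.
- by rewrite addrAC; apply: point_line.
- have [->|] := eqVneq l k; [exact: two_lines_eq|exact: two_lines_neq].
Qed.

(* Let E = 2p + q.  At p a potential for point_sum - E increases in some
   direction, so p is not a maximum; the other vertices burn in turn, as in
   Dhar's algorithm, and there is no maximum left. *)
Lemma not_rank_ge_point_sum : ~ rank_ge point_sum 3.
Proof.
have /card_gt1P[p [q [_ _ pq]]] : (1 < #|fano_point|)%N by rewrite card_fano_point.
have p_q : (p == q) = false by apply/negbTE.
pose s : seq (vert heawood) := [:: pv p; pv p; pv q].
move=> /(_ (\sum_(v <- s) << vpt v >>)) /= hD.
have {hD} : equiv_effective (point_sum - << vpt (pv p) >> - << vpt (pv p) >> - << vpt (pv q) >>).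
  rewrite -!addrA -!opprD; have -> : << vpt (pv p) >> + (<< vpt (pv p) >> + << vpt (pv q) >>)
      = \sum_(v <- s) << vpt v >> :> divisor Γ.
    by rewrite !big_cons big_nil addr0.
  apply: hD => [x|].
    rewrite raddf_sum /=; apply: sumr_ge0 => v _; rewrite coeffU mul1r natz //.
  by rewrite !big_cons big_nil addr0 !raddfD /= !degU.
have D0 e t : 0 < t < len Γ e ->
    chips (ept e t) (point_sum - << vpt (pv p) >> - << vpt (pv p) >> - << vpt (pv q) >>) = 0.
  by move=> te; rewrite chipsB1 pair_chips_edge // vertex_neq_edge.
move=> /(heawood_equiv_effectiveP D0)[phi [psi [a [b [ha hb hp hl]]]]].
pose f (v : vert heawood) := match v with inl x => phi x | inr l => psi l end.
have [vm _ max_vm] := @arg_maxP _ _ _ (pv p) predT f isT.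
pose M := f vm.
have leP x : phi x <= M by apply: (max_vm (pv x)).
have leL l : psi l <= M by apply: (max_vm (lv l)).
(* At a maximum no outgoing slope is positive, and each non-maximal neighbour costs at least one
   chip. *)
have a_le0 x l : fano_inc x l -> phi x = M -> a x l <= 0 /\ (psi l != M -> a x l <= -1).
  move=> xl xM; have := ha x l xl; have := flen_gt0 Γ x l; have := leL l; rewrite xM.
  move=> lM n0 h; have am : (a x l)%:~R * flen x l <= 0 by lra.
  have a0 : a x l <= 0 by move: am; rewrite pmulr_lle0 // lerz0.
  split=> // lN; have [E|] := eqVneq (a x l) 0; last by move: a0; clear; lia.
  by case/eqP: lN; apply/le_anti; rewrite lM /=; move: h; rewrite E mul0r addr0.
have b_le0 x l : fano_inc x l -> psi l = M -> b x l <= 0 /\ (phi x != M -> b x l <= -1).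
  move=> xl xM; have := hb x l xl; have := flen_gt0 Γ x l; have := leP x; rewrite xM.
  move=> lM n0 h; have am : (b x l)%:~R * flen x l <= 0 by lra.
  have a0 : b x l <= 0 by move: am; rewrite pmulr_lle0 // lerz0.
  split=> // lN; have [E|] := eqVneq (b x l) 0; last by move: a0; clear; lia.
  by case/eqP: lN; apply/le_anti; rewrite lM /=; move: h; rewrite E mul0r addr0.
have p_notmax : phi p != M.
  apply/eqP => pM; have := hp p; rewrite !vertE [q == p]eq_sym p_q subr0 /=.
  have [l1 [l2 [l3 tr]]] := fano_pencil_exists p; have [i1 i2 i3] := triad_mem tr.
  rewrite (triad_sum _ tr).
  have [h1 _] := a_le0 p l1 i1 pM; have [h2 _] := a_le0 p l2 i2 pM.
  have [h3 _] := a_le0 p l3 i3 pM.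
  by move: h1 h2 h3; clear; lia.
(* A line has no chip, so all neighbours of a maximal line are maximal. *)
have line_points x l : fano_inc x l -> psi l = M -> phi x = M.
  move=> xl lM; apply/eqP/negPn/negP => xM.
  have [x2 [x3 tr]] := fano_range xl; have [_ i2 i3] := triad_mem tr.
  have := hl l; rewrite !vertE /= (triad_sum _ tr).
  have [_ /(_ xM) h1] := b_le0 x l xl lM.
  have [h2 _] := b_le0 x2 l i2 lM; have [h3 _] := b_le0 x3 l i3 lM.
  by move: h1 h2 h3; clear; lia.
(* A point other than [p] has at most one chip and cannot pay for two non-maximal lines. *)
have point_lines x l1 l2 : fano_inc x l1 -> fano_inc x l2 -> l1 != l2 ->
    phi x = M -> psi l1 != M -> psi l2 != M -> False.
  move=> xl1 xl2 l12 xM l1M l2M; have xp : (p == x) = false.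
    by apply/negbTE; apply: contraNneq p_notmax => ->; rewrite xM.
  have [l3 tr] := fano_pencil2 xl1 xl2 l12; have [_ _ i3] := triad_mem tr.
  have := hp x; rewrite !vertE xp (triad_sum _ tr).
  have [_ /(_ l1M) h1] := a_le0 x l1 xl1 xM.
  have [_ /(_ l2M) h2] := a_le0 x l2 xl2 xM.
  have [h3 _] := a_le0 x l3 i3 xM.
  by move: h1 h2 h3; case: (q == x); clear; lia.
(* No chip is left at [q], while its line to [p] is already known to be non-maximal. *)
have q_notmax : phi q != M.
  apply/eqP => qM; have [k pk qk] := fano_join p q.
  have kM : psi k != M by apply: contraNneq p_notmax => /(line_points p k pk) ->.
  have [l2 [l3 tr]] := fano_pencil qk; have [_ i2 i3] := triad_mem tr.
  have := hp q; rewrite !vertE p_q (triad_sum _ tr).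
  have [_ /(_ kM) h1] := a_le0 q k qk qM.
  have [h2 _] := a_le0 q l2 i2 qM; have [h3 _] := a_le0 q l3 i3 qM.
  by move: h1 h2 h3; clear; lia.
have line_p l : fano_inc p l -> psi l != M.
  by move=> pl; apply: contraNneq p_notmax => /(line_points p l pl) ->.
have line_q l : fano_inc q l -> psi l != M.
  by move=> ql; apply: contraNneq q_notmax => /(line_points q l ql) ->.
(* For [x] on [l] off the line joining [p] and [q], the lines from [x] to [p] and to [q] are
   distinct and both non-maximal, too many for the chip of [x]. *)
have no_line l : psi l != M.
  apply/eqP => lM; have [k pk qk] := fano_join p q.
  have lk : l != k by apply/eqP => lk; have := line_p k pk; rewrite -lk lM eqxx.
  have [x1 [x2 [x3 tr]]] := fano_range_exists l.
  have [x xl xk] : exists2 x, fano_inc x l & ~~ fano_inc x k.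
    have [x12 _ _] := triad_neq tr; have [x1l x2l _] := triad_mem tr.
    have [x1k|] := boolP (fano_inc x1 k); last by exists x1.
    exists x2 => //; apply: contraNN lk => x2k.
    by rewrite (fano_uniq (negbT x12) x1l x2l x1k x2k).
  have [k1 xk1 pk1] := fano_join x p; have [k2 xk2 qk2] := fano_join x q.
  apply: (point_lines x k1 k2) => //; [|exact: line_points lM|exact: line_p|exact: line_q].
  apply: contraNneq xk => k12; rewrite -k12 in qk2.
  by rewrite -(fano_uniq (negbT p_q) pk1 qk2 pk qk).
have no_point x : phi x != M.
  apply/eqP => xM; have [l1 [l2 [l3 tr]]] := fano_pencil_exists x.
  have [l12 _ _] := triad_neq tr; have [i1 i2 _] := triad_mem tr.
  exact: (point_lines x l1 l2 i1 i2 (negbT l12) xM (no_line l1) (no_line l2)).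
by case: vm @M {max_vm leP leL a_le0 b_le0 point_lines line_points p_notmax q_notmax line_p line_q}
  no_line no_point => [x|l] M no_line no_point; [have := no_point x|have := no_line l]; rewrite eqxx.
Qed.

End RankTwo.

Theorem theorem1p1 (R : realType) (Γ : metric_graph R heawood) :
  (exists D : divisor Γ, deg D = 7%:Z /\ rank D = 2%:Z) /\
  genus heawood = 8%N /\
  rho 8 2 7 = -1 /\
  BN_special Γ.
Proof.
have rk : rank (point_sum Γ) = 2%:Z.
  exact: rank_eq (@rank_ge_point_sum R Γ) (@not_rank_ge_point_sum R Γ).
have gen : genus heawood = 8%N.
  have := genus_euler heawood; rewrite card_sum !card_fano_point.
  have -> : #|edge heawood| = 21%N.
    rewrite card_sig -sum1_card.
    rewrite (eq_bigl (fun x : fano_point * fano_line => true && fano_inc x.1 x.2)) //.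
    rewrite -(pair_big_dep predT fano_inc (fun _ _ => 1%N)) /=.
    rewrite (eq_bigr (fun=> 3%N)) => [|p _].
      by rewrite sum_nat_const card_fano_point.
    have [l1 [l2 [l3 tr]]] := fano_pencil_exists p.
    by rewrite sum1_card; apply: triad_card tr.
  by lia.
split; first by exists (point_sum Γ); rewrite deg_point_sum.
split=> //; split; first by rewrite /rho.
(* Generality would make the locus for r = 2 and d = 7 empty, but it contains the class of
   [point_sum]. *)
move=> /(_ 2%N 7%N isT isT)[]; rewrite gen => /(_ isT) W0 _.
have : W Γ 2 7 (pic_class (point_sum Γ)).
  by exists (point_sum Γ) => //; split; rewrite ?deg_point_sum ?rk.
by rewrite W0.
Qed.
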